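(* Let $k>2$ be an integer and assume that the $(\ell,k)$-Hyperclique Hypothesis holds for every integer $\ell>k$. Then the Shortest Cycle problem in directed unweighted graphs with $m$ edges requires $m^{k/(k-1)-o(1)}$ time on a Word-RAM with $O(\log n)$-bit words.
   Context: A $k$-uniform hypergraph has hyperedges that are $k$-element vertex subsets. An $\ell$-hyperclique in a $k$-uniform hypergraph is a set of $\ell>k$ vertices all of whose $k$-element subsets are hyperedges. $(\ell,k)$-Hyperclique Hypothesis (for integers $\ell>k>2$): on a Word-RAM with $O(\log n)$-bit words, finding an $\ell$-hyperclique in a $k$-uniform hypergraph on $n$ nodes requires $n^{\ell-o(1)}$ time. Shortest Cycle in an unweighted directed graph: find a directed cycle with the minimum number of edges. *)

(* Defs.v *)
From HB Require Import structures.
From mathcomp Require Import all_boot all_order all_algebra.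
From mathcomp Require Import reals exp.

Set Implicit Arguments.
Unset Strict Implicit.
Unset Printing Implicit Defensive.

Local Open Scope nat_scope.

(* Word-RAM with w-bit words: words are naturals below 2 ^ w, registers and   *)
(* memory cells hold one word each, every instruction costs one time unit.    *)

Inductive binop :=
  | OpAdd | OpSub | OpMul | OpDiv | OpMod
  | OpAnd | OpOr | OpXor | OpShl | OpShr.

Inductive instr :=
  | Const of nat & nat            (* r_i := c            *)
  | Op of binop & nat & nat & nat (* r_i := r_j op r_k   *)
  | Read of nat & nat             (* r_i := M[r_j]       *)
  | Write of nat & nat            (* M[r_i] := r_j       *)
  | Jump of nat                   (* goto a              *)
  | JumpEq of nat & nat & nat     (* if r_i = r_j goto a *)
  | JumpLt of nat & nat & nat.    (* if r_i < r_j goto a *)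

Definition program := seq instr.

Record state := State { pc : nat; regs : nat -> nat; memory : nat -> nat }.

Definition update (f : nat -> nat) (i v : nat) : nat -> nat :=
  fun j => if j == i then v else f j.

(* Results are truncated to w bits; division by zero gives x %/ 0 = 0 and     *)
(* x %% 0 = x.                                                                *)
Definition eval_binop (w : nat) (o : binop) (x y : nat) : nat :=
  (match o with
   | OpAdd => x + y
   | OpSub => x + (2 ^ w - y)
   | OpMul => x * y
   | OpDiv => x %/ y
   | OpMod => x %% y
   | OpAnd => Nat.land x y
   | OpOr => Nat.lor x y
   | OpXor => Nat.lxor x y
   | OpShl => x * 2 ^ y
   | OpShr => x %/ 2 ^ y
   end) %% 2 ^ w.

Definition exec (w : nat) (i : instr) (s : state) : state :=
  let: State a r m := s in
  match i with
  | Const d c => State a.+1 (update r d (c %% 2 ^ w)) m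
  | Op o d x y => State a.+1 (update r d (eval_binop w o (r x) (r y))) m
  | Read d x => State a.+1 (update r d (m (r x))) m
  | Write x y => State a.+1 r (update m (r x) (r y))
  | Jump b => State b r m
  | JumpEq x y b => State (if r x == r y then b else a.+1) r m
  | JumpLt x y b => State (if r x < r y then b else a.+1) r m
  end.

(* The machine halts when the program counter leaves the program.             *)
Definition halted (p : program) (s : state) : bool := size p <= pc s.

Definition step (w : nat) (p : program) (s : state) : state :=
  if onth p (pc s) is Some i then exec w i s else s.

Definition run (w : nat) (p : program) (t : nat) (s : state) : state :=
  iter t (step w p) s.

(* The input occupies the memory cells from address 0 on, all the other cells *)
(* and all the registers being 0.                                             *)
Definition init_state (s : seq nat) : state := State 0 (fun=> 0) (nth 0 s).

(* The output is the length-prefixed sequence starting at address 0.          *)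
Definition output (s : state) : seq nat :=
  mkseq (fun i => memory s i.+1) (memory s 0).

(* A search problem on (hyper)graphs. An instance may have several encodings  *)
(* as a sequence of words, and an algorithm has to handle all of them.        *)
Record problem := Problem {
  instance : Type;
  nodes : instance -> nat;
  time_param : instance -> nat;    (* the N of a running time O(f N) *)
  encodes : instance -> seq nat -> Prop;
  solution : instance -> seq nat -> Prop }.

(* (trunc_log 2 n).+1 is the bit length of n > 0.                             *)
Definition word_size (c n : nat) : nat := c * (trunc_log 2 n).+1.

(* Solvability in time O(f) on a Word-RAM with O(log n)-bit words: both the   *)
(* program and the constant c in the word size belong to the algorithm. The   *)
(* input must fit in the memory addressable with such words.                  *)
Definition solvable_in_time (R : realType) (P : problem) (f : nat -> R) : Prop :=
  exists (p : program) (c : nat) (C : R) (N0 : nat),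
  forall (x : instance P) (s : seq nat), encodes x s ->
  let w := word_size c (nodes x) in
  [/\ size s <= 2 ^ w,
      all (fun v => v < 2 ^ w) s
    & exists t : nat,
      [/\ halted p (run w p t (init_state s)),
          solution x (output (run w p t (init_state s)))
        & N0 <= time_param x -> (t%:R <= C * f (time_param x))%R]].

(* "P requires time N ^ (a - o(1))".                                          *)
Definition requires_time (R : realType) (P : problem) (a : R) : Prop :=
  forall eps : R, (0 < eps)%R ->
  ~ solvable_in_time P (fun N => (N%:R `^ (a - eps))%R).

Record hypergraph (k : nat) := Hypergraph {
  hnodes : nat;
  hedges : {set {set 'I_hnodes}};
  hedges_card : forall e, e \in hedges -> #|e| = k }.

Definition is_hyperclique (l k : nat) (H : hypergraph k)
    (S : {set 'I_(hnodes H)}) : Prop :=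
  #|S| = l /\
  forall e : {set 'I_(hnodes H)}, e \subset S -> #|e| = k -> e \in hedges H.

(* The vertices that occur among the k digits of i in base n.                 *)
Definition digit_set (n k i : nat) : {set 'I_n} :=
  [set x : 'I_n | [exists j : 'I_k, val x == (i %/ n ^ j) %% n]].

(* A hypergraph is given by its adjacency tensor: the number n of nodes,      *)
(* followed by n ^ k bits, the one of index \sum_(j < k) v_j * n ^ j telling  *)
(* whether {v_0, ..., v_(k-1)} is a hyperedge (it is 0 if two v_j coincide).  *)
Definition hypergraph_code (k : nat) (H : hypergraph k) : seq nat :=
  hnodes H ::
  mkseq (fun i => nat_of_bool (digit_set (hnodes H) k i \in hedges H))
        (hnodes H ^ k).

(* The output lists the vertices of an l-hyperclique in some order; it is     *)
(* empty if there is none.                                                    *)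
Definition hyperclique_solution (l k : nat) (H : hypergraph k) (out : seq nat)
    : Prop :=
  (exists q : seq 'I_(hnodes H),
     [/\ uniq q, is_hyperclique l [set x in q] & out = map val q]) \/
  ((forall S : {set 'I_(hnodes H)}, ~ is_hyperclique l S) /\ out = [::]).

Definition hyperclique_problem (l k : nat) : problem :=
  {| instance := hypergraph k;
     nodes := @hnodes k;
     time_param := @hnodes k;
     encodes := fun H s => s = hypergraph_code H;
     solution := @hyperclique_solution l k |}.

Definition hyperclique_hypothesis (R : realType) (l k : nat) : Prop :=
  requires_time (hyperclique_problem l k) (l%:R : R)%R.

Record digraph := Digraph {
  dnodes : nat;
  arcs : {set 'I_dnodes * 'I_dnodes};
  arcs_loopless : forall u, (u, u) \notin arcs }.

Definition is_dicycle (G : digraph) (c : seq 'I_(dnodes G)) : Prop :=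
  c <> [::] /\ ucycle (fun u v => (u, v) \in arcs G) c.

(* size c is the number of edges of the cycle c.                              *)
Definition is_shortest_cycle (G : digraph) (c : seq 'I_(dnodes G)) : Prop :=
  is_dicycle c /\
  forall c' : seq 'I_(dnodes G), is_dicycle c' -> size c <= size c'.

(* A digraph is given by its numbers of nodes and edges, followed by the list *)
(* of its edges in an arbitrary order.                                        *)
Definition digraph_encodes (G : digraph) (s : seq nat) : Prop :=
  exists2 es : seq ('I_(dnodes G) * 'I_(dnodes G)),
    perm_eq es (enum (arcs G))
  & s = dnodes G :: size es ::
        flatten [seq [:: val a.1; val a.2] | a <- es].

Definition shortest_cycle_solution (G : digraph) (out : seq nat) : Prop :=
  (exists2 c : seq 'I_(dnodes G), is_shortest_cycle c & out = map val c) \/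
  ((forall c : seq 'I_(dnodes G), ~ is_dicycle c) /\ out = [::]).

Definition shortest_cycle_problem : problem :=
  {| instance := digraph;
     nodes := dnodes;
     time_param := fun G => #|arcs G|;
     encodes := digraph_encodes;
     solution := shortest_cycle_solution |}.

(* Main.v *)
Require Import Defs.
From mathcomp Require Import all_boot all_order all_algebra.
From mathcomp Require Import reals exp.
From mathcomp Require Import zify ring lra.

(** Put l = k q. Searching for an l-hyperclique v_0, ..., v_(l-1) in a k-uniform
    hypergraph on n vertices is reduced to Shortest Cycle in a circular layered
    digraph with l layers: the nodes of layer i are the tuples
    (v_i, ..., v_(i+gam-1)), indices modulo l, where gam = q (k-1), and the arcs
    from layer i to layer i+1 are the windows (v_i, ..., v_(i+gam)) all of whose
    k-subsets are hyperedges. Since k positions on a circle of length k q leave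
    q-1 consecutive positions free, every k-subset of positions lies in a window.
    Hence closed walks have length at least l, and those of length l are exactly
    the hypercliques. The digraph has m = l n^(gam+1) arcs, and
    m^(k/(k-1) - eps) = O(n^(l-1)) as soon as eps q >= k/(k-1) + 1.

    On the Word-RAM, a tuple is a number in base n, so that shifting it is a
    division by n. Tuples that are not windows become arcs from one extra node to
    distinct sinks, which makes the number of arcs equal to m; isolated nodes pad
    the number of nodes to a power of two for which the word size of the digraph
    instance equals a word size c' log n of the hypergraph instance. The given
    shortest-cycle program thus runs unchanged, except that its registers and jump
    targets are shifted, once the digraph has been moved to address 0 of an
    otherwise empty memory. *)

Set Implicit Arguments.
Unset Strict Implicit.
Unset Printing Implicit Defensive.

(** * Reasoning about Word-RAM code *)

(* The reduction works in the registers below [scratch]; those of the simulated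
   program are shifted above it. *)
Definition scratch := 20.

(* Jumps are absolute, hence code is parametrised by its address. *)
Definition code := nat -> seq instr.
Definition assertion := (nat -> nat) -> (nat -> nat) -> Prop.

Definition block (cs : seq instr) : code := fun=> cs.
Definition then_code (c d : code) : code :=
  fun o => c o ++ d (o + size (c o)).
Definition until_code (test : nat -> instr) (c : code) : code :=
  fun o => test (o + size (c o.+1)).+2 :: c o.+1 ++ [:: Jump o].
Definition unless_code (test : nat -> instr) (c : code) : code :=
  fun o => test (o + size (c o.+1)).+1 :: c o.+1.

Section Triples.

Variable w : nat.

(** Hoare triple for total correctness: the code, placed anywhere, reaches its end within [Tm]
    steps. The frame condition keeps the registers from [scratch] on at their initial zeros until
    the simulated program starts. *)
Definition triple (P : assertion) (c : code) (Tm : nat) (Q : assertion) :=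
  forall (pre post : program) r m, P r m ->
  let o := size pre in
  exists t r' m',
    [/\ t <= Tm,
        run w (pre ++ c o ++ post) t (State o r m) =
          State (o + size (c o)) r' m',
        Q r' m'
      & forall i, scratch <= i -> r' i = r i].

Lemma run_add p a b s : run w p (a + b) s = run w p b (run w p a s).
Proof. by rewrite /run addnC iterD. Qed.

Lemma onth_mid (p q : program) i : onth (p ++ i :: q) (size p) = Some i.
Proof. by elim: p => //= a p. Qed.

Lemma triple_weaken (P P' : assertion) c Tm Tm' (Q Q' : assertion) :
  (forall r m, P' r m -> P r m) -> (forall r m, Q r m -> Q' r m) ->
  Tm <= Tm' -> triple P c Tm Q -> triple P' c Tm' Q'.
Proof.
move=> hP hQ hT h pre post r m /hP /h-/(_ pre post)[t [r' [m' [h1 h2 /hQ h3 h4]]]].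
by exists t, r', m'; split=> //; apply: leq_trans hT.
Qed.

Lemma triple_then (P Q U : assertion) c d T1 T2 :
  triple P c T1 Q -> triple Q d T2 U -> triple P (then_code c d) (T1 + T2) U.
Proof.
move=> hc hd pre post r m Pr o.
have [t1 [r1 [m1 [le1 run1 Q1 fr1]]]] := hc pre (d (o + size (c o)) ++ post) r m Pr.
have [t2 [r2 [m2 [le2 run2 U2 fr2]]]] := hd (pre ++ c o) post r1 m1 Q1.
exists (t1 + t2), r2, m2; split=> // [|| i hi].
- exact: leq_add.
- rewrite run_add /then_code -catA run1.
  by move: run2; rewrite !size_cat -!catA addnA.
- by rewrite fr2 // fr1.
Qed.

(** Besides propagating [Q] backwards through straight-line code, it demands that no constant or
    result be truncated. For operations outside the four listed, the value [2 ^ w] makes that demand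
    fail. *)
Fixpoint wp (cs : seq instr) (Q : assertion) : assertion :=
  fun r m =>
  if cs is i :: cs' then
    match i with
    | Const d c => [/\ d < scratch, c < 2 ^ w & wp cs' Q (update r d c) m]
    | Op o d x y =>
        let v := match o with
                 | OpAdd => r x + r y
                 | OpMul => r x * r y
                 | OpDiv => r x %/ r y
                 | OpMod => r x %% r y
                 | _ => 2 ^ w
                 end in
        [/\ d < scratch, v < 2 ^ w & wp cs' Q (update r d v) m]
    | Read d x => d < scratch /\ wp cs' Q (update r d (m (r x))) m
    | Write x y => wp cs' Q r (update m (r x) (r y))
    | _ => False
    end
  else Q r m.

Lemma wp_cat cs1 cs2 Q r m :
  wp cs1 (fun r' m' => wp cs2 Q r' m') r m -> wp (cs1 ++ cs2) Q r m.
Proof.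
elim: cs1 r m => //= -[d c|o d x y|d x|x y|a|x y a|x y a] cs1 IH r m //=.
- by case=> h1 h2 /IH.
- by case=> h1 h2 /IH.
- by case=> h1 /IH.
- by move/IH.
Qed.

Lemma update_frame f d v i : d < scratch -> scratch <= i -> update f d v i = f i.
Proof. by move=> hd hi; rewrite /update gtn_eqF // (leq_trans hd). Qed.

Lemma triple_block (P Q : assertion) cs :
  (forall r m, P r m -> wp cs Q r m) -> triple P (block cs) (size cs) Q.
Proof.
move=> h pre post r m /h {h} /= hwp; rewrite /block.
exists (size cs).
elim: cs pre r m hwp => [|i cs IH] pre r m.
  by move=> /= Qr; exists r, m; split=> //; rewrite addn0.
have run1 r1 m1 (r0 := r) : (exec w i (State (size pre) r m) = State (size pre).+1 r1 m1) ->
    wp cs Q r1 m1 -> (forall j, scratch <= j -> r1 j = r0 j) ->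
    exists r' m', [/\ size (i :: cs) <= size (i :: cs),
     run w (pre ++ (i :: cs) ++ post) (size (i :: cs)) (State (size pre) r0 m) =
     State (size pre + size (i :: cs)) r' m', Q r' m' &
     forall j, scratch <= j -> r' j = r0 j].
  move=> he /(IH (rcons pre i)) [r' [m' [_ h2 h3 h4]]] h5.
  exists r', m'; split=> // [|j hj]; last by rewrite h4 // h5.
  move: h2; rewrite size_rcons cat_rcons addSnnS => <-.
  rewrite -[X in run _ _ X]/(1 + size cs) run_add; congr run.
  by rewrite /run /= /step /= onth_mid.
case: i run1 => [d c|o d x y|d x|x y|a|x y a|x y a] run1 //=.
- case=> hd hc hwp; apply: (run1 _ _ _ hwp); first by rewrite /= modn_small.
  by move=> j; apply: update_frame.
- case=> hd hv hwp; apply: (run1 _ _ _ hwp); last by move=> j; apply: update_frame.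
  by case: o hv {hwp run1} => /= hv; [| by rewrite ltnn in hv | | | |
    by rewrite ltnn in hv ..]; rewrite /eval_binop modn_small.
- case=> hd hwp; apply: (run1 _ _ _ hwp) => //.
  by move=> j; apply: update_frame.
- by move=> hwp; apply: (run1 _ _ _ hwp).
Qed.

Definition decides (test : nat -> instr) (b : (nat -> nat) -> bool) :=
  forall a o r m,
    exec w (test a) (State o r m) = State (if b r then a else o.+1) r m.

Lemma decides_eq i j : decides (JumpEq i j) (fun r => r i == r j).
Proof. by []. Qed.

Lemma decides_lt i j : decides (JumpLt i j) (fun r => r i < r j).
Proof. by []. Qed.

(** [I i] is the invariant after [i] rounds. A round costs a test, the body and the jump back; one
    more test leaves the loop. *)
Lemma triple_until test b c (I : nat -> assertion) k Tm :
  decides test b ->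
  (forall i r m, i < k -> I i r m -> ~~ b r) ->
  (forall r m, I k r m -> b r) ->
  (forall i, i < k -> triple (I i) c Tm (I i.+1)) ->
  triple (I 0) (until_code test c) (k * Tm.+2).+1 (I k).
Proof.
move=> dec nb bk body pre post.
set o := size pre.
set p := pre ++ until_code test c o ++ post.
have hp : p = pre ++ until_code test c o ++ post by [].
have hp1 : p = rcons pre (test (o + size (c o.+1)).+2) ++ c o.+1 ++ Jump o :: post.
  by rewrite hp /until_code /= cat_rcons -catA.
have hp2 : p = (rcons pre (test (o + size (c o.+1)).+2) ++ c o.+1) ++ Jump o :: post.
  by rewrite hp1 -catA.
have test_step r m : step w p (State o r m) =
    State (if b r then (o + size (c o.+1)).+2 else o.+1) r m.
  by rewrite /step /= {1}hp /until_code /= onth_mid; apply: dec.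
(* Induction on the number [d] of rounds that remain. *)
suff main d : d <= k -> forall r m, I (k - d) r m ->
    exists t r' m', [/\ t <= (d * Tm.+2).+1,
      run w p t (State o r m) = State (o + size (until_code test c o)) r' m',
      I k r' m' & forall i, scratch <= i -> r' i = r i].
  by move=> r m; have := main k (leqnn k) r m; rewrite subnn.
elim: d => [_ r m|d IH hd r m hI].
  rewrite subn0 => hI; exists 1, r, m; split=> //.
  rewrite /run /= test_step (bk _ _ hI) /until_code /= size_cat /=.
  by congr State; lia.
have hlt : k - d.+1 < k by lia.
have [t1 [r1 [m1 [le1 run1 I1 fr1]]]] :=
  body _ hlt (rcons pre (test (o + size (c o.+1)).+2)) (Jump o :: post) r m hI.
have ek : (k - d.+1).+1 = k - d by lia.
rewrite ek in I1.
have [t2 [r2 [m2 [le2 run2 I2 fr2]]]] := IH (ltnW hd) _ _ I1.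
exists (1 + (t1 + (1 + t2))), r2, m2; split=> // [||i hi].
- rewrite mulSn; lia.
- rewrite 3!run_add {1 2 3}/run /= test_step (negbTE (nb _ _ _ hlt hI)).
  move: run1; rewrite size_rcons -hp1 => run1.
  have -> : iter t1 (step w p) (State o.+1 r m) = State (o.+1 + size (c o.+1)) r1 m1.
    exact: run1.
  have -> : step w p (State (o.+1 + size (c o.+1)) r1 m1) = State o r1 m1.
    rewrite /step -[pc _]/(o.+1 + size (c o.+1)).
    have -> : o.+1 + size (c o.+1) = size (rcons pre (test (o + size (c o.+1)).+2) ++ c o.+1).
      by rewrite size_cat size_rcons.
    by rewrite {1}hp2 /= onth_mid.
  exact: run2.
- by rewrite fr2 // fr1.
Qed.

Lemma triple_unless test b c (P Q : assertion) Tm :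
  decides test b ->
  (forall r m, P r m -> b r -> Q r m) ->
  triple (fun r m => P r m /\ ~~ b r) c Tm Q ->
  triple P (unless_code test c) Tm.+1 Q.
Proof.
move=> dec hb hc pre post r m hP o.
have run1 : run w (pre ++ unless_code test c o ++ post) 1 (State o r m) =
    State (if b r then (o + size (c o.+1)).+1 else o.+1) r m.
  by rewrite /run /= /step /= /unless_code onth_mid; apply: dec.
have [br|nbr] := boolP (b r).
  exists 1, r, m; split=> //; last exact: hb.
  by rewrite run1 br addnS.
have [t1 [r1 [m1 [le1 run2 Q1 fr1]]]] :=
  hc (rcons pre (test (o + size (c o.+1)).+1)) post r m (conj hP nbr).
exists (1 + t1), r1, m1; split=> //.
rewrite run_add run1 (negbTE nbr) /unless_code /=.
by move: run2; rewrite size_rcons cat_rcons addSnnS.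
Qed.

End Triples.

(** * The program that builds the digraph *)

Definition digit (n e p : nat) : nat := (e %/ n ^ p) %% n.
(** Horner's rule: the index, in the adjacency tensor, of the vertices standing at the positions [t]
    of the tuple [e]. *)
Definition tuple_index (n e : nat) (t : seq nat) : nat :=
  foldl (fun a p => a * n + digit n e p) 0 t.

Lemma tuple_index_rcons n e t p :
  tuple_index n e (rcons t p) = tuple_index n e t * n + digit n e p.
Proof. by rewrite /tuple_index -cats1 foldl_cat. Qed.

Lemma tuple_index_lt n e t : 0 < n -> tuple_index n e t < n ^ size t.
Proof.
move=> n_gt0; elim/last_ind: t => // t p IH.
rewrite tuple_index_rcons size_rcons expnS mulnC.
have := ltn_pmod (e %/ n ^ p) n_gt0; rewrite -/(digit _ _ _); nia.
Qed.

Section Wp.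
Variable w : nat.

Lemma wp_nseq_mul j d y (Q : assertion) r m :
  d < scratch -> y != d -> (forall i, i <= j -> r d * r y ^ i < 2 ^ w) ->
  (forall r', r' d = r d * r y ^ j -> (forall i, i != d -> r' i = r i) -> Q r' m) ->
  wp w (nseq j (Op OpMul d d y)) Q r m.
Proof.
move=> hd hy; elim: j r => [|j IH] r hb hQ /=.
  by apply: hQ => //; rewrite muln1.
have e1 : update r d (r d * r y) d = r d * r y by rewrite /update eqxx.
have e2 : update r d (r d * r y) y = r y by rewrite /update (negbTE hy).
split=> //; first by have := hb 1 isT; rewrite expn1.
apply: IH => [i hi|r' h1 h2].
  by rewrite e1 e2 -mulnA -expnS; apply: hb.
apply: hQ => [|i hi]; first by rewrite h1 e1 e2 -mulnA -expnS.
by rewrite h2 // /update (negbTE hi).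
Qed.

Lemma wp_nseq_div j d y (Q : assertion) r m :
  d < scratch -> y != d -> r d < 2 ^ w ->
  (forall r', r' d = r d %/ r y ^ j -> (forall i, i != d -> r' i = r i) -> Q r' m) ->
  wp w (nseq j (Op OpDiv d d y)) Q r m.
Proof.
move=> hd hy; elim: j r => [|j IH] r hb hQ /=.
  by apply: hQ => //; rewrite divn1.
have e1 : update r d (r d %/ r y) d = r d %/ r y by rewrite /update eqxx.
have e2 : update r d (r d %/ r y) y = r y by rewrite /update (negbTE hy).
have hb1 : r d %/ r y < 2 ^ w by apply: leq_ltn_trans hb; apply: leq_div.
split=> //.
apply: IH => [|r' h1 h2]; first by rewrite e1.
apply: hQ => [|i hi]; first by rewrite h1 e1 e2 -divnMA -expnS.
by rewrite h2 // /update (negbTE hi).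
Qed.

Lemma wp_op v o d x y cs (Q : assertion) r m :
  d < scratch ->
  match o with
  | OpAdd => r x + r y = v
  | OpMul => r x * r y = v
  | OpDiv => r x %/ r y = v
  | OpMod => r x %% r y = v
  | _ => False
  end ->
  v < 2 ^ w -> wp w cs Q (update r d v) m -> wp w (Op o d x y :: cs) Q r m.
Proof. by move=> hd hv hw h; case: o hv => //= ->. Qed.

End Wp.

Ltac wp_op_with v tac :=
  apply: (@wp_op _ v); [by [] | by rewrite /update /=; tac | | ].

(* Register use: 0 holds n, 1 the constant 1, 2 n^gam, 3 n^(gam+1), 4 l n^gam,
   5 the loop bound, 6 the number N of nodes, 7 the loop counter x, 8 the window
   flag, 9 the tuple e, 12 and 13 the arc, 14 the write address, 16 l, 17 zero. *)
Definition digit_code (p : nat) : seq instr :=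
  Op OpMul 11 9 1 :: nseq p (Op OpDiv 11 11 0) ++
  [:: Op OpMod 11 11 0; Op OpMul 10 10 0; Op OpAdd 10 10 11].

Definition index_code (t : seq nat) : seq instr :=
  Const 10 0 :: flatten [seq digit_code p | p <- t].

(** The flag is multiplied by the bit read. The address is one more than the tensor index because
    cell 0 holds [n]. *)
Definition test_code (t : seq nat) : seq instr :=
  index_code t ++ [:: Op OpAdd 10 10 1; Read 11 10; Op OpMul 8 8 11].

Definition genuine_code : seq instr :=
  [:: Op OpDiv 10 7 3; Op OpMul 11 10 2; Op OpMod 12 9 2; Op OpAdd 12 12 11;
      Op OpAdd 10 10 1; Op OpMod 10 10 16; Op OpMul 10 10 2;
      Op OpDiv 13 9 0; Op OpAdd 13 13 10].

(** The arc to a sink is prepared first and overwritten if the flag is still 1. A product with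
    register 1 serves as a copy instruction. *)
Definition emit_code (tps : seq (seq nat)) : code :=
  then_code
    (block ([:: Op OpMod 9 7 3; Const 8 1] ++ flatten [seq test_code t | t <- tps] ++
            [:: Op OpMul 12 4 1; Op OpAdd 13 4 1; Op OpAdd 13 13 7]))
  (then_code (unless_code (JumpEq 8 17) (block genuine_code))
    (block [:: Write 14 12; Op OpAdd 14 14 1; Write 14 13;
               Op OpAdd 14 14 1; Op OpAdd 7 7 1])).

Definition move_code : seq instr :=
  [:: Op OpAdd 14 6 7; Read 11 14; Write 14 17; Write 7 11; Op OpAdd 7 7 1].

Definition setup_code (l gam : nat) : seq instr :=
  (* Register 11 is still 0, so the first instruction reads [n] from cell 0. *)
  [:: Read 0 11; Const 17 0; Const 1 1; Const 2 1] ++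
  nseq gam (Op OpMul 2 2 0) ++
  [:: Op OpMul 3 2 0; Const 16 l; Op OpMul 4 16 2; Op OpMul 5 16 3;
      Const 12 2; Const 13 2].

(** Register 13 enters as [2 ^ L.+1] with [L = trunc_log 2 n], so register 6 becomes
    [N = 2 ^ L * (2 ^ L.+1) ^ g]. It is both the first word of the digraph code and the address of
    that word, whence [Write 6 6]. *)
Definition header_code (g : nat) : seq instr :=
  Op OpDiv 6 13 12 :: nseq g (Op OpMul 6 6 13) ++
  [:: Write 6 6; Op OpAdd 14 6 1; Write 14 5; Op OpAdd 14 14 1; Const 7 0].

Definition prologue (tps : seq (seq nat)) (l gam g : nat) : code :=
  then_code (block (setup_code l gam))
  (then_code (until_code (JumpLt 0 13) (block [:: Op OpMul 13 13 12]))
  (then_code (block (header_code g))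
  (then_code (until_code (JumpEq 7 5) (emit_code tps))
  (then_code (block [:: Const 7 0; Op OpAdd 5 5 5; Op OpAdd 5 5 1; Op OpAdd 5 5 1])
             (until_code (JumpEq 7 5) (block move_code)))))).

Section Arcs.
Variables (n gam l : nat) (ok : nat -> bool).

(** [x] codes the layer [x %/ n ^ gam.+1] and the tuple [e]. A node of layer [i] is its tuple plus
    [i * n ^ gam]; the number [l * n ^ gam] is the extra node. *)
Definition arc_src (x : nat) : nat :=
  let e := x %% n ^ gam.+1 in
  if ok e then e %% n ^ gam + x %/ n ^ gam.+1 * n ^ gam else l * n ^ gam.

Definition arc_dst (x : nat) : nat :=
  let e := x %% n ^ gam.+1 in
  if ok e then e %/ n + ((x %/ n ^ gam.+1).+1 %% l) * n ^ gam
  else l * n ^ gam + 1 + x.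

End Arcs.

(** * Correctness of the code that builds the digraph *)

Section Prologue.

Variables (w n k gam l g N : nat) (bit : nat -> bool) (tps : seq (seq nat)).

Let hc := n :: mkseq (fun i => nat_of_bool (bit i)) (n ^ k).
Let ok e := all (fun t => bit (tuple_index n e t)) tps.
Let m := l * n ^ gam.+1.
Let src := arc_src n gam l ok.
Let dst := arc_dst n gam l ok.

Hypothesis l_gt0 : 0 < l.
Hypothesis gam_gt0 : 0 < gam.
Hypothesis k_le : k <= gam.+1.
Hypothesis tps_size : all (fun t => size t == k) tps.
Hypothesis N_def : N = 2 ^ (trunc_log 2 n) * (2 ^ (trunc_log 2 n).+1) ^ g.
(** The construction computes addresses up to [N + 2 m + 2], which [m_N] puts below [2 N]. *)
Hypothesis N_w : 2 * N <= 2 ^ w.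
Hypothesis m_N : m * 2 + 3 <= N.
Hypothesis Zm_N : l * n ^ gam + 1 + m <= N.
Hypothesis hc_N : n ^ k < N.
Hypothesis l_N : l <= N.
Hypothesis pow_N : forall j, j <= gam.+1 -> n ^ j <= N.
Hypothesis log_N : 2 ^ (trunc_log 2 n).+1 <= N.

Definition graph_code (x : nat) : seq nat :=
  N :: m :: flatten [seq [:: src j; dst j] | j <- iota 0 x].

Definition consts (r : nat -> nat) : Prop :=
  [/\ r 0 = n, r 1 = 1, r 2 = n ^ gam, r 3 = n ^ gam.+1
    & [/\ r 4 = l * n ^ gam, r 6 = N, r 16 = l & r 17 = 0]].

(* The digraph is first written from address N on, above the hypergraph. *)
Definition building (s : seq nat) (M : nat -> nat) : Prop :=
  forall a, M a = if a < N then nth 0 hc a else nth 0 s (a - N).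

Lemma building_write s v M :
  building s M -> building (rcons s v) (update M (N + size s) v).
Proof.
move=> h a; rewrite /update h nth_rcons.
case: (ltngtP a (N + size s)) => ha; case: ltnP => // haN; try lia.
- by rewrite ifT //; lia.
- rewrite ifN; last by lia.
  rewrite ifN; last by apply/eqP; lia.
  by rewrite nth_default //; lia.
- by rewrite ifN ?ifT //; lia.
Qed.

Lemma graph_codeS x :
  graph_code x.+1 = rcons (rcons (graph_code x) (src x)) (dst x).
Proof. by rewrite /graph_code -addn1 iotaD map_cat flatten_cat /= -!cats1 /= -!catA. Qed.

Lemma size_graph_code x : size (graph_code x) = x * 2 + 2.
Proof. by elim: x => // x IH; rewrite graph_codeS !size_rcons IH; lia. Qed.

Lemma wp_digit p (Q : assertion) r M :
  r 0 = n -> r 1 = 1 -> r 9 < 2 ^ w -> 0 < n ->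
  r 10 * n + digit n (r 9) p < 2 ^ w ->
  (forall r', r' 10 = r 10 * n + digit n (r 9) p ->
     (forall i, i \notin [:: 10; 11] -> r' i = r i) -> Q r' M) ->
  wp w (digit_code p) Q r M.
Proof.
move=> r0 r1 r9 n_gt0 hb hQ; rewrite /digit_code /=; split=> //.
  by rewrite r1 muln1.
apply: wp_cat; apply: wp_nseq_div => //.
  by rewrite /update /= r1 muln1.
rewrite {1 2}/update /= r0 r1 muln1 => r' h1 h2.
have e0 : r' 0 = n by rewrite h2.
have e10 : r' 10 = r 10 by rewrite h2.
rewrite /update /= h1 e0 e10 -/(digit n (r 9) p); split=> //; first by lia.
split=> //; first by lia.
split=> //; apply: hQ => //= i; rewrite !inE negb_or => /andP[i10 i11].
by rewrite (negbTE i10) (negbTE i11) h2 // /update (negbTE i11).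
Qed.

Lemma wp_index t (Q : assertion) r M :
  r 0 = n -> r 1 = 1 -> r 9 < 2 ^ w -> 0 < n -> n ^ size t <= 2 ^ w ->
  (forall r', r' 10 = tuple_index n (r 9) t ->
     (forall i, i \notin [:: 10; 11] -> r' i = r i) -> Q r' M) ->
  wp w (index_code t) Q r M.
Proof.
move=> r0 r1 r9 n_gt0 hb hQ; rewrite /index_code /=.
split=> //; first by rewrite expn_gt0.
set r1' := update r 10 0.
(* The bound [a.+1 * n ^ size t <= 2 ^ w] on the accumulator [a] survives each Horner step because
   the next digit is below [n]. *)
suff main a r2 : r2 10 = a -> (forall i, i \notin [:: 10; 11] -> r2 i = r i) ->
    a.+1 * n ^ size t <= 2 ^ w ->
    (forall r', r' 10 = foldl (fun a p => a * n + digit n (r 9) p) a t ->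
     (forall i, i \notin [:: 10; 11] -> r' i = r i) -> Q r' M) ->
    wp w (flatten [seq digit_code p | p <- t]) Q r2 M.
  apply: (main 0) => //; last by rewrite mul1n.
  by move=> i; rewrite !inE negb_or /r1' /update => /andP[/negbTE-> _].
move=> {r1' hQ hb}; elim: t a r2 => [|p t IH] a r2 h10 hr hb hQ; first exact: hQ.
have e0 : r2 0 = n by rewrite hr.
have e1 : r2 1 = 1 by rewrite hr.
have e9 : r2 9 = r 9 by rewrite hr.
have dlt : digit n (r 9) p < n by apply: ltn_pmod.
have hb1 : (a * n + digit n (r 9) p).+1 * n ^ size t <= 2 ^ w.
  apply: leq_trans hb; rewrite /= expnS mulnA leq_mul2r; apply/orP; right; nia.
rewrite -[flatten _]/(digit_code p ++ flatten [seq digit_code p | p <- t]).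
apply: wp_cat; apply: wp_digit => //; rewrite ?e9 ?h10 //.
  apply: leq_trans hb1; apply: leq_pmulr; by rewrite expn_gt0 n_gt0.
move=> r' h1 h2; apply: (IH _ _ h1) => // i hi.
by rewrite h2 // hr.
Qed.

Lemma building_bit s M i : building s M -> i < n ^ k -> M i.+1 = bit i.
Proof.
by move=> -> hi; rewrite ifT ?(leq_ltn_trans hi) //= nth_mkseq.
Qed.

Lemma wp_test t b s (Q : assertion) r M :
  size t = k -> r 0 = n -> r 1 = 1 -> r 9 < 2 ^ w -> 0 < n -> building s M ->
  r 8 = nat_of_bool b ->
  (forall r', r' 8 = nat_of_bool (b && bit (tuple_index n (r 9) t)) ->
     (forall i, i \notin [:: 8; 10; 11] -> r' i = r i) -> Q r' M) ->
  wp w (test_code t) Q r M.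
Proof.
move=> st r0 r1 r9 n_gt0 hM r8 hQ.
have hlt := tuple_index_lt (r 9) t n_gt0; rewrite st in hlt.
have w_gt1 : 1 < 2 ^ w by lia.
apply: wp_cat; apply: wp_index => //; first by rewrite st; lia.
move=> r' h1 h2; rewrite /= /update /= h1.
have -> : r' 1 = 1 by rewrite h2.
have -> : r' 8 = b by rewrite h2.
rewrite addn1 (building_bit hM) // mulnb; split=> //; first by lia.
split=> //; split=> //; first exact: leq_ltn_trans (leq_b1 _) w_gt1.
apply: hQ => //= i; rewrite !inE !negb_or => /and3P[/negbTE-> /negbTE h10 /negbTE h11].
by rewrite h10 h11 h2 // !inE h10 h11.
Qed.

Lemma wp_tests b s (Q : assertion) r M :
  r 0 = n -> r 1 = 1 -> r 9 < 2 ^ w -> 0 < n -> building s M ->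
  r 8 = nat_of_bool b ->
  (forall r', r' 8 = nat_of_bool (b && ok (r 9)) ->
     (forall i, i \notin [:: 8; 10; 11] -> r' i = r i) -> Q r' M) ->
  wp w (flatten [seq test_code t | t <- tps]) Q r M.
Proof.
rewrite /ok => r0 r1 r9 n_gt0 hM.
elim: tps tps_size b r r0 r1 r9 => [|t ts IH] h b r r0 r1 r9 r8 hQ.
  by apply: hQ => //; rewrite andbT.
case/andP: h => /eqP st h.
rewrite -[flatten _]/(test_code t ++ flatten [seq test_code t | t <- ts]).
apply: wp_cat; apply: (wp_test st _ _ _ _ hM r8) => // r' h1 h2.
have e9 : r' 9 = r 9 by rewrite h2.
apply: (IH h _ r' _ _ _ h1); rewrite ?h2 // => r'' h3 h4.
apply: hQ => [|i hi]; first by rewrite h3 andbA.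
by rewrite h4 // h2.
Qed.

Definition emit_inv (x : nat) : assertion := fun r M =>
  [/\ consts r, r 5 = m, r 7 = x, r 14 = N + (x * 2 + 2)
    & building (graph_code x) M].

Definition emit_time : nat :=
  size ([:: Op OpMod 9 7 3; Const 8 1] ++ flatten [seq test_code t | t <- tps] ++
        [:: Op OpMul 12 4 1; Op OpAdd 13 4 1; Op OpAdd 13 13 7]) + 15.

Lemma emit_triple x : x < m ->
  triple w (emit_inv x) (emit_code tps) emit_time (emit_inv x.+1).
Proof.
move=> hx.
have n_gt0 : 0 < n by case: (posnP n) hx => // n0; rewrite /m n0 exp0n // muln0.
have E_gt0 : 0 < n ^ gam.+1 by rewrite expn_gt0 n_gt0.
have T_gt0 : 0 < n ^ gam by rewrite expn_gt0 n_gt0.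
have e_lt : x %% n ^ gam.+1 < n ^ gam.+1 by rewrite ltn_pmod.
have i_lt : x %/ n ^ gam.+1 < l by rewrite ltn_divLR.
have lT_N : l * n ^ gam < N by lia.
have mN : m < N by lia.
pose e := x %% n ^ gam.+1.
have e_N : e < N by rewrite /e; have := pow_N (leqnn gam.+1); lia.
(* [mid] holds once the flag and the default arc are computed, [mid2] once registers 12 and 13
   contain the final arc. *)
pose mid : assertion := fun r M => [/\ emit_inv x r M, r 8 = nat_of_bool (ok e),
  r 9 = e, r 12 = l * n ^ gam & r 13 = l * n ^ gam + 1 + x].
pose mid2 : assertion := fun r M =>
  [/\ emit_inv x r M, r 12 = src x & r 13 = dst x].
rewrite /emit_time -[15]/(10 + 5).
apply: (triple_then (Q := mid)).
  apply: triple_block => r M [[c0 c1 c2 c3 [c4 c6 c16 c17]] r5 r7 r14 hM].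
  apply: wp_cat; rewrite /= /update /= r7 c3 -/e; split=> //; first by lia.
  split=> //; first by lia.
  apply: wp_cat; apply: (wp_tests (b := true) (s := graph_code x)) => //=.
    by lia.
  move=> r' h1 h2.
  rewrite /= /update /= !h2 //= !c4 !c1 !r7 muln1.
  split=> //; first by lia.
  split=> //; first by lia.
  split=> //; first by lia.
  by rewrite /mid /emit_inv /consts /= h1 !h2 //; do !split.
apply: (triple_then (Q := mid2)).
  apply: (triple_unless (decides_eq w 8 17)).
    move=> r M [hI r8 r9 r12 r13]; case: (hI) => -[_ _ _ _ [_ _ _ ->]] _ _ _ _.
    rewrite r8 => /eqP h0; split=> //; rewrite /src /dst /arc_src /arc_dst -/e;
      by case: (ok e) h0.
  apply: triple_block => r M [[hI r8 r9 r12 r13]]; case: (hI) =>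
    -[c0 c1 c2 c3 [c4 c6 c16 c17]] r5 r7 r14 hM.
  rewrite r8 c17 => hok; have {hok}hok : ok e by case: (ok e) hok.
  have eT : e %% n ^ gam < n ^ gam by rewrite ltn_pmod.
  have en : e %/ n < n ^ gam by rewrite ltn_divLR // -expnSr.
  have il : (x %/ n ^ gam.+1 + 1) %% l < l by rewrite ltn_pmod.
  have iT : x %/ n ^ gam.+1 * n ^ gam + n ^ gam <= l * n ^ gam.
    by rewrite -mulSnr leq_mul2r i_lt orbT.
  have small v : v < l * n ^ gam -> v < 2 ^ w by move: lT_N N_w; clear; lia.
  have smallN v : v <= N -> v < 2 ^ w by move: lT_N N_w; clear; lia.
  rewrite /genuine_code.
  pose i := x %/ n ^ gam.+1; pose i' := (i + 1) %% l.
  have iT' : i' * n ^ gam + n ^ gam <= l * n ^ gam.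
    by rewrite -mulSnr leq_mul2r il orbT.
  have b1 : e %% n ^ gam + i * n ^ gam < l * n ^ gam.
    by rewrite addnC; apply: leq_trans iT; rewrite ltn_add2l.
  have b2 : e %/ n + i' * n ^ gam < l * n ^ gam.
    by rewrite addnC; apply: leq_trans iT'; rewrite ltn_add2l.
  wp_op_with i ltac:(rewrite r7 c3).
    by apply: smallN; apply: leq_trans l_N; apply: ltnW.
  wp_op_with (i * n ^ gam) ltac:(rewrite c2).
    by apply: small; apply: leq_ltn_trans b1; apply: leq_addl.
  wp_op_with (e %% n ^ gam) ltac:(rewrite r9 c2).
    by apply: small; apply: leq_ltn_trans b1; apply: leq_addr.
  wp_op_with (e %% n ^ gam + i * n ^ gam) idtac; first exact: small.
  wp_op_with (i + 1) ltac:(rewrite c1).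
    by apply: smallN; apply: leq_trans l_N; rewrite addn1.
  wp_op_with i' ltac:(rewrite c16).
    by apply: smallN; apply: leq_trans l_N; apply: ltnW.
  wp_op_with (i' * n ^ gam) ltac:(rewrite c2).
    by apply: small; apply: leq_ltn_trans b2; apply: leq_addl.
  wp_op_with (e %/ n) ltac:(rewrite r9 c0).
    by apply: small; apply: leq_ltn_trans b2; apply: leq_addr.
  wp_op_with (e %/ n + i' * n ^ gam) idtac; first exact: small.
  rewrite /wp /mid2 /emit_inv /consts /update /=.
  split=> //=; rewrite /i' /i /src /dst /arc_src /arc_dst -/e hok // addn1 //.
have -> : 5 = size [:: Write 14 12; Op OpAdd 14 14 1; Write 14 13;
               Op OpAdd 14 14 1; Op OpAdd 7 7 1] by [].
apply: triple_block => r M [[[c0 c1 c2 c3 [c4 c6 c16 c17]] r5 r7 r14 hM] r12 r13].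
have sz := size_graph_code x.
rewrite /= /update /= r14 c1 r12 r13 r7.
split=> //; first by lia.
split=> //; first by lia.
split=> //; first by lia.
split=> //=.
- by rewrite addn1.
- by lia.
- rewrite graph_codeS.
  have /(building_write (dst x)) := building_write (src x) hM.
  by rewrite size_rcons sz -[(x * 2 + 2).+1]addn1 [N + (_ + 1)]addnA.
Qed.

(** Each cell above [N] is cleared as it is copied, since the simulated program expects zeros beyond
    its input. *)
Definition moving (x : nat) : assertion := fun r M =>
  [/\ consts r, r 5 = m * 2 + 2, r 7 = x
    & forall a, M a = if a < x then nth 0 (graph_code m) a
                      else if a < N then nth 0 hc a
                      else if a < N + x then 0
                      else nth 0 (graph_code m) (a - N)].

Lemma move_triple x : x < m * 2 + 2 ->
  triple w (moving x) (block move_code) 5 (moving x.+1).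
Proof.
move=> hx; rewrite -[5]/(size move_code).
apply: triple_block => r M [[c0 c1 c2 c3 [c4 c6 c16 c17]] r5 r7 hM].
rewrite /= /update /= c6 r7 c1 c17.
split=> //; first by lia.
split=> //; split=> //; first by lia.
split=> //=; first by rewrite addn1.
move=> a; rewrite !hM.
case: (a =P x) => [->|ax].
  rewrite ltnSn; case: ifP => [|_]; first by lia.
  case: ifP => [|_]; first by lia.
  by rewrite ltnn addnC addnK.
case: (a =P N + x) => [->|aNx].
  have N_gt0 : 0 < N by move: m_N; clear; lia.
  rewrite ifN; last by rewrite -leqNgt -{1}[x]add0n ltn_add2r.
  by rewrite ifN ?ifT // ?addnS // -leqNgt leq_addr.
have xne : (a == x) = false by apply/eqP.
have Nxne : (a == N + x) = false by apply/eqP.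
have -> : (a < x.+1) = (a < x) by rewrite ltnS leq_eqVlt xne.
have -> : (a < N + x.+1) = (a < N + x) by rewrite addnS ltnS leq_eqVlt Nxne.
by [].
Qed.

Definition prologue_time : nat :=
  size (setup_code l gam) + ((trunc_log 2 n * 3).+1 + (size (header_code g) +
   ((m * emit_time.+2).+1 + (4 + ((m * 2 + 2) * 7).+1)))).

(** The final memory is the initial memory of the simulated program on the digraph instance;
    register 0 keeps [n] for the decoding. *)
Lemma prologue_triple :
  triple w (fun r M => (forall i, r i = 0) /\ (forall a, M a = nth 0 hc a))
    (prologue tps l gam g) prologue_time
    (fun r M => r 0 = n /\ (forall a, M a = nth 0 (graph_code m) a)).
Proof.
pose L := trunc_log 2 n.
have w2 : 2 ^ L.+1 < 2 ^ w.
  by apply: leq_ltn_trans log_N _; move: N_w m_N; clear; lia.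
pose base r := [/\ r 0 = n, r 1 = 1, r 2 = n ^ gam, r 3 = n ^ gam.+1
  & [/\ r 4 = l * n ^ gam, r 5 = m, r 16 = l, r 17 = 0 & r 12 = 2]].
(* After [i] doublings register 13 is [2 ^ i.+1]; it first exceeds [n] at [i = L]. *)
pose I1 i : assertion := fun r M => [/\ base r, r 13 = 2 ^ i.+1 & forall a, M a = nth 0 hc a].
apply: (triple_then (Q := I1 0)).
  apply: triple_block => r M [r0 hM].
  apply: wp_cat; rewrite /= /update /= !r0 hM /=.
  do 4![split=> //; try by lia].
  apply: wp_cat; apply: wp_nseq_mul => //=.
    by move=> i hi; rewrite mul1n; have := pow_N (leqW hi); lia.
  rewrite mul1n => r' h1 h2; rewrite /= /update /= h1 !h2 //= -expnSr -/m.
  have e1 := pow_N (leqnn gam.+1).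
  do 6![split=> //; first by lia].
  by split=> //; split=> //=; rewrite h2.
apply: (triple_then (Q := I1 L)).
  apply: (triple_until (Tm := 1) (decides_lt w 0 13)).
  - move=> i r M hi [[-> _ _ _ _] -> _]; rewrite -leqNgt.
    have n_gt0 : 0 < n by case: (posnP n) hi => // n0; rewrite /L n0.
    by apply: leq_trans (trunc_logP (ltnSn 1) n_gt0); rewrite leq_exp2l.
  - by move=> r M [[-> _ _ _ _] -> _]; apply: trunc_log_ltn.
  - move=> i hi; rewrite -[1]/(size [:: Op OpMul 13 13 12]).
    apply: triple_block => r M [[c0 c1 c2 c3 [c4 c5 c16 c17 c12]] r13 hM].
    rewrite /= /update /= c12 r13 -expnSr; split=> //.
    by apply: leq_ltn_trans w2; rewrite leq_exp2l.
apply: (triple_then (Q := emit_inv 0)).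
  apply: triple_block => r M [[c0 c1 c2 c3 [c4 c5 c16 c17 c12]] r13 hM].
  rewrite /header_code.
  wp_op_with (2 ^ L) ltac:(rewrite r13 c12 expnSr mulnK).
    by apply: ltn_trans w2; rewrite ltn_exp2l.
  apply: wp_cat; apply: wp_nseq_mul => //=; rewrite /update /= r13.
    move=> i hi; apply: (@leq_ltn_trans N); last by move: N_w m_N; clear; lia.
    rewrite N_def leq_mul2l; apply/orP; right.
    by rewrite leq_pexp2l // expn_gt0.
  rewrite -N_def => r' h1 h2.
  rewrite h1 !h2 //= c1 c5.
  split=> //; first by move: N_w m_N; clear; lia.
  split=> //; first by move: N_w m_N; clear; lia.
  split=> //; first by move: N_w m_N; clear; lia.
  split=> //=; rewrite ?h2 //.
  - by rewrite /consts /= h1 !h2 //; split.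
  - by rewrite -addnA.
  - have hb0 : building [::] M.
      move=> a; rewrite nth_nil hM; case: ltnP => // ha.
      by rewrite nth_default //= size_mkseq; apply: leq_trans ha.
    have := building_write m (building_write N hb0).
    by rewrite /= addn0.
apply: (triple_then (Q := emit_inv m)).
  apply: (triple_until (decides_eq w 7 5)).
  - by move=> i r M hi [_ -> -> _ _]; rewrite ltn_eqF.
  - by move=> r M [_ -> -> _ _].
  - by move=> i hi; apply: emit_triple.
apply: (triple_then (Q := moving 0)).
  rewrite -[4]/(size [:: Const 7 0; Op OpAdd 5 5 5; Op OpAdd 5 5 1; Op OpAdd 5 5 1]).
  apply: triple_block => r M [[c0 c1 c2 c3 [c4 c6 c16 c17]] r5 r7 r14 hM].
  rewrite /= /update /= r5 c1.
  split=> //; first by move: N_w m_N; clear; lia.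
  do 3![split=> //; first by move: N_w m_N; clear; lia].
  split=> //=; first by clear; lia.
  by move=> a; rewrite hM addn0; case: ltnP.
apply: (@triple_weaken _ (moving 0) _ _ ((m * 2 + 2) * 7).+1 _ (moving (m * 2 + 2))) => //.
- move=> r M [[-> _ _ _ _] _ _ hM]; split=> // a; rewrite hM.
  have sz := size_graph_code m.
  case: ltnP => // ha; rewrite (nth_default _ (s := graph_code m) (n := a)) ?sz //.
  case: ltnP => haN.
    (* The hypergraph code, of length [n ^ k + 1], is not longer than the digraph code, of length
       [2 m + 2], so nothing of it is left above the latter. *)
    rewrite nth_default //= size_mkseq.
    apply: leq_trans ha; case: (posnP n) => [->|n_gt0].
      by apply: (@leq_trans 2); [case: (k) => // k'; rewrite exp0n | apply: leq_addl].
    have h1 : n ^ k <= n ^ gam.+1 by rewrite leq_pexp2l.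
    have h2 : n ^ gam.+1 <= m by rewrite /m leq_pmull.
    by move: (leq_trans h1 h2); clear; lia.
  case: ltnP => // haN2; rewrite nth_default // sz; by lia.
- apply: (triple_until (Tm := 5) (decides_eq w 7 5)).
  - by move=> i r M hi [_ -> -> _]; rewrite ltn_eqF.
  - by move=> r M [_ -> -> _].
  - by move=> i hi; apply: move_triple.
Qed.

End Prologue.

(** * Running the shortest-cycle program and decoding its output *)

(** A jump to any address beyond the program halts it. Capping targets at [sz] makes the relocated
    program leave exactly at its end, where the decoding starts. *)
Definition relocate_instr (o sz : nat) (i : instr) : instr :=
  match i with
  | Const d c => Const (scratch + d) c
  | Op b d x y => Op b (scratch + d) (scratch + x) (scratch + y)
  | Read d x => Read (scratch + d) (scratch + x)
  | Write x y => Write (scratch + x) (scratch + y)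
  | Jump a => Jump (o + minn a sz)
  | JumpEq x y a => JumpEq (scratch + x) (scratch + y) (o + minn a sz)
  | JumpLt x y a => JumpLt (scratch + x) (scratch + y) (o + minn a sz)
  end.

Definition relocate (p : program) : code :=
  fun o => map (relocate_instr o (size p)) p.

Section Relocation.

Variables (w : nat) (p pre post : program).
Let o := size pre.
Let big := pre ++ relocate p o ++ post.

Definition mirrors (r0 : nat -> nat) (s S : state) : Prop :=
  [/\ pc S = o + minn (pc s) (size p),
      forall i, regs S (scratch + i) = regs s i,
      forall i, i < scratch -> regs S i = r0 i
    & memory S =1 memory s].

Lemma onth_relocated a i :
  onth p a = Some i -> onth big (o + a) = Some (relocate_instr o (size p) i).
Proof.
move=> hi; have lt_a : a < size p.
  by rewrite ltnNge; apply/negP => h; rewrite onth_default in hi.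
rewrite /big onthE !map_cat nth_cat size_map ltnNge leq_addr /= addKn nth_cat.
by rewrite size_map size_map lt_a -onthE /relocate onth_map hi.
Qed.

Lemma update_shift f d v i : update f (scratch + d) v (scratch + i) =
  if i == d then v else f (scratch + i).
Proof. by rewrite /update eqn_add2l. Qed.

Lemma update_low f d v i : i < scratch -> update f (scratch + d) v i = f i.
Proof. by move=> hi; rewrite /update ltn_eqF // (leq_trans hi) ?leq_addr. Qed.

Lemma mirrors_step r0 s S : pc s < size p -> mirrors r0 s S ->
  mirrors r0 (step w p s) (step w big S).
Proof.
case: s S => a r M [A R M'] /= lt_a [/= hA hR hlow hM].
rewrite (minn_idPl (ltnW lt_a)) in hA.
case hi : (onth p a) => [i|]; last first.
  by move: hi; rewrite onthE (nth_map (Const 0 0)).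
rewrite /step /= hi hA (onth_relocated hi).
have next : (o + a).+1 = o + minn a.+1 (size p) by rewrite (minn_idPl lt_a) addnS.
case: i {hi} => [d c|b d x y|d x|x y|b|x y b|x y b] /=; split=> //=;
  try (by move=> i; rewrite update_shift ?hR /update; case: eqP => // _; rewrite ?hM ?hR);
  try (by move=> i hi; rewrite update_low ?hlow).
- by move=> j; rewrite /update !hR hM.
- by rewrite !hR; case: ifP.
- by rewrite !hR; case: ifP.
Qed.

(** A halted program stands still, whereas its relocated copy would run on into the code that
    follows. The count [t'] therefore stops at the halting step. *)
Lemma mirrors_run r0 s S t : mirrors r0 s S ->
  exists2 t', t' <= t & mirrors r0 (run w p t s) (run w big t' S).
Proof.
elim: t s S => [|t IH] s S h; first by exists 0.
have [lt_pc|ge_pc] := ltnP (pc s) (size p).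
  have [t' le_t' h'] := IH _ _ (mirrors_step lt_pc h).
  by exists t'.+1 => //; rewrite /run !iterSr.
exists 0 => //; suff -> : run w p t.+1 s = s by [].
elim: t.+1 => //= u; rewrite /run /= => ->.
by rewrite /step onth_default.
Qed.

End Relocation.

(** A node is a tuple in base [n] plus a multiple of [n ^ gam], so its residue modulo [n] is the
    first vertex of the tuple. *)
Definition reduce_code (l : nat) : seq instr :=
  flatten [seq [:: Const 14 i.+1; Read 15 14; Op OpMod 15 15 0; Write 14 15]
          | i <- iota 0 l].

(** If the cycle length is not [l] there is no hyperclique, and the output length becomes 0. Cell 0
    then holds [l] or 0; reading it again replaces an else branch. *)
Definition epilogue (l : nat) : code :=
  then_code (block [:: Const 11 0; Const 12 l; Read 13 11])
  (then_code (unless_code (JumpEq 13 12) (block [:: Write 11 11]))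
  (then_code (block [:: Read 13 11])
             (unless_code (JumpEq 13 11) (block (reduce_code l))))).

Lemma wp_reduce w n l (Q : assertion) r M :
  r 0 = n -> 0 < n -> n <= 2 ^ w -> l < 2 ^ w ->
  (forall r' M', r' 0 = n -> M' 0 = M 0 ->
     (forall i, M' i.+1 = if i < l then M i.+1 %% n else M i.+1) -> Q r' M') ->
  wp w (reduce_code l) Q r M.
Proof.
move=> r0 n_gt0 n_w; elim: l Q => [|l IH] Q l_w hQ; first exact: hQ.
rewrite /reduce_code -[l.+1]addn1 iotaD map_cat flatten_cat add0n.
apply: wp_cat; apply: IH => [|r' M' h0 hM0 hM]; first exact: ltnW.
rewrite /= /update /= h0 hM ltnn.
have hmod : M l.+1 %% n < 2 ^ w by apply: leq_trans n_w; rewrite ltn_pmod.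
do 3![split=> //]; apply: hQ => //= i; rewrite hM eqSS ltnS.
by rewrite [i <= l]leq_eqVlt; case: (i =P l) => [->|].
Qed.

Lemma epilogue_triple w n l len c :
  0 < l -> l < 2 ^ w -> (len = l -> 0 < n) -> n <= 2 ^ w ->
  (len = l -> size c = l) ->
  triple w
    (fun r M => [/\ r 0 = n, M 0 = len &
       len = l -> forall i, i < l -> M i.+1 = nth 0 c i])
    (epilogue l) (size (reduce_code l) + 7)
    (fun _ M => mkseq (fun i => M i.+1) (M 0) =
                if len == l then [seq x %% n | x <- c] else [::]).
Proof.
move=> l_gt0 l_w n_gt0 n_w sz.
have w_gt0 : 0 < 2 ^ w by rewrite expn_gt0.
pose I (v : nat) : assertion := fun r M => [/\ r 0 = n, r 11 = 0, M 0 = v &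
  len = l -> forall i, i < l -> M i.+1 = nth 0 c i].
pose v := if len == l then l else 0.
apply: (@triple_weaken _ _ _ _ (3 + (2 + (1 + (size (reduce_code l)).+1))) _ _ _
  (fun _ _ => id) (fun _ _ => id)); first by lia.
apply: (triple_then (Q := fun r M => [/\ I len r M, r 12 = l & r 13 = len])).
  rewrite -[3]/(size [:: Const 11 0; Const 12 l; Read 13 11]).
  by apply: triple_block => r M [r0 hM0 hM]; rewrite /= /update /=.
apply: (triple_then (Q := I v)).
  apply: (triple_unless (decides_eq w 13 12)).
    move=> r M [[r0 r11 hM0 hM] -> ->] /eqP h; split=> //.
    by rewrite hM0 /v h eqxx.
  rewrite -[1]/(size [:: Write 11 11]).
  apply: triple_block => r M [[[r0 r11 hM0 hM] -> ->] h].
  rewrite /= /update r11; split=> //=; first by rewrite /v (negbTE h).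
apply: (triple_then (Q := fun r M => I v r M /\ r 13 = v)).
  rewrite -[1]/(size [:: Read 13 11]).
  by apply: triple_block => r M [r0 r11 hM0 hM]; rewrite /= /update /= r11 hM0.
apply: (triple_unless (decides_eq w 13 11)).
  move=> r M [[r0 r11 hM0 hM] ->]; rewrite r11 hM0 => /eqP hv.
  by move: hv; rewrite /v; case: ifP => // /eqP _ hl; move: l_gt0; rewrite hl.
apply: triple_block => r M [[[r0 r11 hM0 hM] ->]]; rewrite r11 => hv.
have hl : len = l by move: hv; rewrite /v; case: ifP => // /eqP.
apply: (wp_reduce r0) => // [|r' M' _ hM0' hM']; first exact: n_gt0.
rewrite hM0' hM0 /v hl eqxx; apply: (@eq_from_nth _ 0).
  by rewrite size_mkseq size_map sz.
move=> i; rewrite size_mkseq => hi.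
by rewrite nth_mkseq // hM' hi hM // (nth_map 0) // sz.
Qed.

(** * Hypercliques and closed walks *)

(** This list depends on [W] and [k] only, so that the same program serves all hypergraphs. *)
Definition pos_tuples (W k : nat) : seq (seq nat) :=
  [seq map val (tval t) | t <- enum {: k.-tuple 'I_W} & uniq (tval t)].

Lemma mem_pos_tuples W k t :
  (t \in pos_tuples W k) = [&& size t == k, uniq t & all (fun p => p < W) t].
Proof.
apply/mapP/and3P => [[u]|[/eqP st ut /allP ht]].
  rewrite mem_filter => /andP[uu _] ->; split.
  - by rewrite size_map size_tuple.
  - by rewrite map_inj_uniq //; apply: val_inj.
  - by apply/allP => p /mapP[x _ ->]; apply: ltn_ord.
have [u hu] : exists u : seq 'I_W, map val u = t.
  exists (pmap insub t); rewrite pmap_filter; last exact: insubK.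
  by apply/all_filterP/allP => p /ht hp /=; rewrite insubT.
have su : size u == k by rewrite -st -hu size_map.
exists (Tuple su) => //; rewrite mem_filter mem_enum andbT /=.
by move: ut; rewrite -hu map_inj_uniq //; apply: val_inj.
Qed.

Lemma digit0 n e : digit n e 0 = e %% n.
Proof. by rewrite /digit divn1. Qed.

Lemma digitS n e p : digit n e p.+1 = digit n (e %/ n) p.
Proof. by rewrite /digit expnS divnMA. Qed.

Lemma digit_mod n g e p : p < g -> digit n (e %% n ^ g) p = digit n e p.
Proof.
elim: p g e => [|p IH] [|g] e // hp.
  by rewrite !digit0 modn_dvdm // expnS dvdn_mulr.
rewrite !digitS -(IH g (e %/ n)) //; congr digit.
by rewrite expnSr modn_divl.
Qed.

(** The last position of [t] gives the lowest digit, hence the induction from the right; the set of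
    digits forgets the order. *)
Lemma digit_set_tuple_index n e t : 0 < n ->
  digit_set n (size t) (tuple_index n e t) =
  [set x : 'I_n | val x \in [seq digit n e p | p <- t]].
Proof.
move=> n_gt0; apply/setP => x; rewrite !inE.
elim/last_ind: t => [|t p IH].
  by apply/existsP => -[[]].
rewrite map_rcons mem_rcons inE -IH size_rcons tuple_index_rcons.
set a := tuple_index n e t; set d := digit n e p.
have hd : d < n by rewrite ltn_pmod.
have e0 : (a * n + d) %/ n ^ 0 %% n = d by rewrite divn1 modnMDl modn_small.
have eS j : (a * n + d) %/ n ^ j.+1 %% n = a %/ n ^ j %% n.
  by rewrite expnS divnMA divnMDl // (divn_small hd) addn0.
apply/existsP/orP => [[[[|j] hj]] /=|[hx|/existsP[j hj]]].
- by rewrite e0; left.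
- by rewrite eS => h; right; apply/existsP; exists (Ordinal (hj : j < size t)).
- by exists ord0; rewrite /= e0.
- by exists (lift ord0 j); rewrite lift0 eS.
Qed.

(** Inverse to taking digits, with [f 0] lowest. Of a window, reduction modulo a power of [n] drops
    the last vertex and division by [n] drops the first: these are the two ends of its arc. *)
Fixpoint number (n : nat) (f : nat -> nat) (L : nat) : nat :=
  if L is L'.+1 then f 0 + n * number n (fun j => f j.+1) L' else 0.

Lemma eq_number n f g L : f =1 g -> number n f L = number n g L.
Proof. by elim: L f g => //= L IH f g h; rewrite h (IH _ (fun j => g j.+1)). Qed.

Section Number.

Variables (n : nat).

Lemma number_lt f L : (forall j, f j < n) -> number n f L < n ^ L.
Proof.
elim: L f => [|L IH] f hf //=; have /IH := fun j => hf j.+1; have := hf 0.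
by rewrite expnS; nia.
Qed.

Lemma number_div f L : (forall j, f j < n) ->
  number n f L.+1 %/ n = number n (fun j => f j.+1) L.
Proof.
move=> hf /=; have n_gt0 : 0 < n by apply: leq_ltn_trans (hf 0).
by rewrite addnC mulnC divnMDl // divn_small ?addn0.
Qed.

Lemma number_mod f L : (forall j, f j < n) -> number n f L.+1 %% n ^ L = number n f L.
Proof.
elim: L f => [|L IH] f hf; first by rewrite modn1.
have hS j : f j.+1 < n by [].
have step M : number n f M.+1 = f 0 + n * number n (fun j => f j.+1) M by [].
rewrite -[RHS](modn_small (number_lt L.+1 hf)) !step -(IH _ hS) expnS.
move: (number _ _ _) => A.
rewrite {1}(divn_eq A (n ^ L)) mulnDr addnCA mulnCA -modnDml modnMl add0n.
by [].
Qed.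

Lemma digit_number f L p : (forall j, f j < n) -> p < L -> digit n (number n f L) p = f p.
Proof.
move=> hf; elim: p L f hf => [|p IH] [|L] f hf // hp.
  by rewrite digit0 /= addnC mulnC modnMDl modn_small.
by rewrite digitS number_div // IH.
Qed.

End Number.

Lemma cycle_nth (T : Type) (e : rel T) x0 c j : cycle e c -> c <> [::] ->
  e (nth x0 c (j %% size c)) (nth x0 c (j.+1 %% size c)).
Proof.
case: c => // x p /= /(pathP x0) h _.
have hj : j %% (size p).+1 < (size p).+1 by rewrite ltn_pmod.
have := h (j %% (size p).+1); rewrite size_rcons => /(_ hj).
have -> : j.+1 %% (size p).+1 = (j %% (size p).+1).+1 %% (size p).+1.
  by rewrite -(addn1 (j %% _)) modnDml addn1.
move: (j %% _) hj => i hi.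
rewrite -rcons_cons nth_rcons /= hi nth_rcons.
rewrite ltnS leq_eqVlt in hi; case/orP: hi => [/eqP->|hi].
  by rewrite modnn ltnn eqxx.
by rewrite hi modn_small.
Qed.

(* Each of the k positions excludes q - 1 of the k q rotations j. *)
Lemma circular_window k q W K : 0 < q -> W = (k * q - q).+1 ->
  size K = k -> 0 < k ->
  exists2 j, j < k * q & forall p, p \in K -> (p + (k * q - j)) %% (k * q) < W.
Proof.
move=> q_gt0 hW sK k_gt0; set l := k * q.
have l_gt0 : 0 < l by rewrite muln_gt0 k_gt0.
have q_le : q <= l by rewrite leq_pmull.
have [/existsP[j /allP hj]|] := boolP [exists j : 'I_l, all (fun p => (p + (l - j)) %% l < W) K].
  by exists (val j); [exact: ltn_ord | exact: hj].
rewrite negb_exists => /forallP hbad; exfalso.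
have cnt p : \sum_(j < l) (W <= (p + (l - j)) %% l) = q.-1.
  have lt j : (p + (l - j)) %% l < l by rewrite ltn_pmod.
  have hinj : injective (fun j : 'I_l => Ordinal (lt j)).
    move=> i j /(congr1 val) /= /eqP; rewrite eqn_modDl => h; apply/val_inj.
    have : i + (l - i) == j + (l - j) %[mod l] by rewrite !subnKC // ltnW.
    rewrite -[in X in _ == X](modnDmr j) -(eqP h) modnDmr eqn_modDr.
    by rewrite !modn_small // => /eqP.
  rewrite (eq_bigr (fun j : 'I_l => (W <= Ordinal (lt j)) : nat)) //.
  rewrite -(reindex_inj hinj (P := xpredT) (F := fun y : 'I_l => (W <= y) : nat)) /=.
  rewrite -(big_mkord xpredT (fun y => (W <= y) : nat)).
  rewrite (big_cat_nat _ (n := W)) //=; last by rewrite hW; lia.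
  rewrite big_nat_cond big1 => [|i]; last by case: ltnP => //=; rewrite ltnNge => ->.
  rewrite add0n big_nat_cond (eq_bigr (fun=> 1)) => [|i]; last by case/andP => /andP[->].
  rewrite -big_nat_cond sum_nat_const_nat muln1 hW; lia.
have : \sum_(j < l) 1 <= \sum_(j < l) \sum_(p <- K) (W <= (p + (l - j)) %% l).
  apply: leq_sum => j _; have := hbad j; rewrite -has_predC => /hasP[p pK /= hp].
  rewrite (big_rem p) //= (_ : W <= _) ?leq_addr //.
  by rewrite leqNgt.
rewrite exchange_big /= [X in _ <= X](eq_bigr (fun=> q.-1)) => [|p _]; last exact: cnt.
rewrite sum1_card card_ord big_const_seq count_predT sK iter_addn_0 /l; nia.
Qed.

(** * Walks in the layered digraph *)

Section Walks.

Variables (k q : nat) (H : hypergraph k).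
Hypothesis k_gt2 : 2 < k.
Hypothesis q_gt1 : 1 < q.

Let n := hnodes H.
Let l := k * q.
Let gam := q * k.-1.
Let T := n ^ gam.

Definition is_window (e : nat) : bool :=
  all (fun t => digit_set n k (tuple_index n e t) \in hedges H)
      (pos_tuples gam.+1 k).

Let m := l * n ^ gam.+1.
Let src := arc_src n gam l is_window.
Let dst := arc_dst n gam l is_window.

(** Arcs join plain numbers here, so that a walk is a function on [nat] and the number of nodes can
    be chosen later. *)
Definition garc (u v : nat) : Prop := exists2 x, x < m & u = src x /\ v = dst x.

Let gam_gt1 : 1 < gam. Proof. rewrite /gam; nia. Qed.
Let l_gt0 : 0 < l. Proof. rewrite /l; nia. Qed.
Let k_lt_l : k < l. Proof. rewrite /l; nia. Qed.
Let gamE : gam = l - q. Proof. rewrite /gam /l; case: (k) k_gt2 => // k' _; nia. Qed.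
Let gam_lt_l : gam < l. Proof. rewrite gamE; lia. Qed.

Lemma is_windowP e : 0 < n ->
  reflect (forall t, size t = k -> uniq t -> (forall p, p \in t -> p < gam.+1) ->
             [set x : 'I_n | val x \in [seq digit n e p | p <- t]] \in hedges H)
          (is_window e).
Proof.
move=> n_gt0; apply: (iffP allP) => [h t st ut ht|h t].
  have /h : t \in pos_tuples gam.+1 k.
    by rewrite mem_pos_tuples st eqxx ut; apply/allP.
  by rewrite -{1}st digit_set_tuple_index.
rewrite mem_pos_tuples => /and3P[/eqP st ut /allP ht].
by rewrite -{1}st digit_set_tuple_index //; apply: h.
Qed.

Lemma arcs_n_gt0 x : x < m -> 0 < n.
Proof. by case: (posnP n) => // n0; rewrite /m n0 exp0n // muln0. Qed.

Lemma layer_lt x : x < m -> x %/ n ^ gam.+1 < l.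
Proof. by move=> hx; rewrite ltn_divLR // expn_gt0 (arcs_n_gt0 hx). Qed.

Lemma arc_parts_lt e : 0 < n -> e < n ^ gam.+1 -> e %% T < T /\ e %/ n < T.
Proof.
by move=> n_gt0 he; rewrite ltn_pmod ?expn_gt0 ?n_gt0 // ltn_divLR // -expnSr.
Qed.

Lemma node_lt a i : a < T -> i < l -> a + i * T < l * T.
Proof.
move=> ha hi; apply: (@leq_trans (i.+1 * T)); last by rewrite leq_mul2r hi orbT.
by rewrite mulSn ltn_add2r.
Qed.

Lemma src_le x : x < m -> src x <= l * T.
Proof.
move=> hx; have n_gt0 := arcs_n_gt0 hx; rewrite /src /arc_src; case: ifP => // _.
have he : x %% n ^ gam.+1 < n ^ gam.+1 by rewrite ltn_pmod // expn_gt0 n_gt0.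
have [h1 _] := arc_parts_lt n_gt0 he.
exact/ltnW/node_lt/layer_lt.
Qed.

(** Makes the number of arcs exactly [m]. For a window, the source gives the layer and [e %% n], as
    [n] divides [T], and the target gives [e %/ n]. The other arcs start at [l * T] and have
    distinct sinks. *)
Lemma arc_injective x y : x < m -> y < m -> src x = src y -> dst x = dst y -> x = y.
Proof.
move=> hx hy; have n_gt0 := arcs_n_gt0 hx.
have E_gt0 : 0 < n ^ gam.+1 by rewrite expn_gt0 n_gt0.
have T_gt0 : 0 < T by rewrite expn_gt0 n_gt0.
have hex : x %% n ^ gam.+1 < n ^ gam.+1 by rewrite ltn_pmod.
have hey : y %% n ^ gam.+1 < n ^ gam.+1 by rewrite ltn_pmod.
have lx := layer_lt hx; have ly := layer_lt hy.
rewrite /src /arc_src /dst /arc_dst -/T.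
have [hx1 hx2] := arc_parts_lt n_gt0 hex.
have [hy1 hy2] := arc_parts_lt n_gt0 hey.
have nT : n %| T by rewrite /T -(prednK (ltnW gam_gt1)) expnS dvdn_mulr.
have modT a b : a < T -> (a + b * T) %/ T = b.
  by move=> ha; rewrite addnC divnMDl // divn_small ?addn0.
case: ifP => wx; case: ifP => wy.
- move=> hs hd.
  have ei : x %/ n ^ gam.+1 = y %/ n ^ gam.+1.
    by rewrite -(modT _ (x %/ _) hx1) hs modT.
  rewrite ei in hs hd; move/addIn: hs => hs; move/addIn: hd => hd.
  rewrite (divn_eq x (n ^ gam.+1)) (divn_eq y (n ^ gam.+1)) ei; congr addn.
  rewrite (divn_eq (x %% _) n) (divn_eq (y %% _) n) hd; congr addn.
  by rewrite -(modn_dvdm (x %% _) nT) hs modn_dvdm.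
- by move=> h; have := node_lt hx1 lx; rewrite h ltnn.
- by move=> h; have := node_lt hy1 ly; rewrite -h ltnn.
- by move=> _ /addnI.
Qed.

(** Sources are at most [l * T] and sinks exceed it, so an arc that can be continued comes from a
    window. *)
Lemma garc_genuine u v v' : garc u v -> garc v v' ->
  exists i e, [/\ i < l, e < n ^ gam.+1, is_window e,
    u = e %% T + i * T & v = e %/ n + (i.+1 %% l) * T].
Proof.
case=> x hx [-> ->] [y hy [hv _]]; have := src_le hy.
rewrite -hv /dst /arc_dst /src /arc_src -/T; case: ifP => [wx _|wx].
  exists (x %/ n ^ gam.+1), (x %% n ^ gam.+1); split=> //.
    exact: layer_lt.
  by rewrite ltn_pmod // expn_gt0 (arcs_n_gt0 hx).
by rewrite -addnA -{2}[l * T]addn0 leq_add2l.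
Qed.

Section Walk.

Variable u : nat -> nat.
Hypothesis walk : forall j, garc (u j) (u j.+1).

Lemma walk_n_gt0 : 0 < n.
Proof. by case: (walk 0) => x /arcs_n_gt0. Qed.

Let T_gt0 : 0 < T. Proof. by rewrite expn_gt0 walk_n_gt0. Qed.
Let nT : n %| T. Proof. by rewrite /T -(prednK (ltnW gam_gt1)) expnS dvdn_mulr. Qed.

Lemma walk_step j : exists i e, [/\ i < l, is_window e, u j %/ T = i,
  u j.+1 %/ T = i.+1 %% l & u j %% T = e %% T /\ u j.+1 %% T = e %/ n].
Proof.
have [i [e [hi he we -> ->]]] := garc_genuine (walk j) (walk j.+1).
have [h1 h2] := arc_parts_lt walk_n_gt0 he.
exists i, e; rewrite ![_ + _ * T]addnC !divnMDl // !modnMDl modn_mod.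
by rewrite (divn_small h1) (divn_small h2) !addn0 (modn_small h2).
Qed.

Lemma walk_layer j : u j %/ T = (u 0 %/ T + j) %% l.
Proof.
elim: j => [|j IH].
  by have [i [e [hi _ -> _ _]]] := walk_step 0; rewrite addn0 modn_small.
have [i [e [hi _ h1 -> _]]] := walk_step j.
by rewrite -h1 IH -(addn1 (_ %% _)) modnDml addn1 addnS.
Qed.

(** Each arc raises the layer by 1 modulo [l], so [l] divides the length of a closed walk. *)
Lemma closed_walk_length s : 0 < s -> u s = u 0 -> l <= s.
Proof.
move=> s_gt0 us; apply: dvdn_leq => //; rewrite /dvdn.
have := walk_layer s; have := walk_layer 0; rewrite us addn0 => {1}-> /eqP.
by rewrite -{1}[u 0 %/ T]addn0 eqn_modDl mod0n eq_sym.
Qed.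

(** Every step shifts the tuple by one digit, so digit [p] becomes the lowest one after [p] steps. A
    walk is thus determined modulo layers by its lowest digits. *)
Lemma walk_digits p j : p < gam -> digit n (u j %% T) p = u (j + p) %% n.
Proof.
elim: p j => [|p IH] j hp; first by rewrite digit0 addn0 modn_dvdm.
have [i [e [_ _ _ _ [h1 h2]]]] := walk_step j.
by rewrite h1 digit_mod // digitS -h2 IH ?addSnnS // ltnW.
Qed.

Lemma walk_window j : exists2 e, is_window e &
  forall p, p < gam.+1 -> digit n e p = u (j + p) %% n.
Proof.
have [i [e [_ we _ _ [h1 h2]]]] := walk_step j; exists e => // -[|p] hp.
  by rewrite -(walk_digits _ (ltnW gam_gt1)) h1 digit_mod // ltnW.
by rewrite digitS -h2 walk_digits // addSnnS.
Qed.

Hypothesis periodic : forall j, u (j %% l) = u j.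

Lemma walk_hedge K : size K = k -> uniq K -> (forall p, p \in K -> p < l) ->
  [set x : 'I_n | val x \in [seq u p %% n | p <- K]] \in hedges H.
Proof.
move=> sK uK hK.
have [j hj hwin] : exists2 j, j < l & forall p, p \in K -> (p + (l - j)) %% l < gam.+1.
  apply: circular_window => //; [lia | by rewrite gamE | lia].
have [e we he] := walk_window j.
(* The positions [K] counted from the start [j] of a window that contains them all. *)
pose t := [seq (p + (l - j)) %% l | p <- K].
have back p : p \in K -> u (j + (p + (l - j)) %% l) = u p.
  move=> /hK hp; rewrite -periodic modnDmr addnCA subnKC ?(ltnW hj) //.
  by rewrite modnDr modn_small.
have ht p : p \in t -> p < gam.+1 by case/mapP => p' /hwin + ->.
have ut : uniq t.
  rewrite map_inj_in_uniq // => a b ha hb /eqP; rewrite eqn_modDr.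
  by rewrite !modn_small ?hK // => /eqP.
have := elimT (is_windowP e walk_n_gt0) we t; rewrite size_map => /(_ sK ut ht).
suff -> : [seq digit n e p | p <- t] = [seq u p %% n | p <- K] by [].
by rewrite -map_comp; apply/eq_in_map => p hp /=; rewrite he ?back // hwin.
Qed.

(** Two positions carrying the same vertex extend to [k] positions. Their vertices form a hyperedge,
    yet number fewer than [k]. *)
Lemma walk_inj a b : a < l -> b < l -> u a %% n = u b %% n -> a = b.
Proof.
move=> ha hb hab; apply/eqP; apply: contraT => neq.
pose rest := [seq p <- iota 0 l | p \notin [:: a; b]].
pose K := a :: b :: take (k - 2) rest.
have urest : uniq rest by rewrite filter_uniq // iota_uniq.
have srest : k - 2 <= size rest.
  have h1 := count_predC (mem [:: a; b]) (iota 0 l); rewrite size_iota in h1.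
  have h2 : count (mem [:: a; b]) (iota 0 l) <= 2.
    rewrite -size_filter; apply: (@uniq_leq_size _ _ [:: a; b]).
      by rewrite filter_uniq // iota_uniq.
    by move=> p; rewrite mem_filter => /andP[].
  have -> : size rest = count (predC (mem [:: a; b])) (iota 0 l) by rewrite size_filter.
  rewrite leq_subLR; apply: leq_trans (ltnW k_lt_l) _.
  by rewrite -[X in X <= _]h1 leq_add2r.
have sK : size K = k by rewrite /= size_takel // -addn2 subnK // ltnW.
have uK : uniq K.
  rewrite /= take_uniq // andbT inE negb_or neq /=.
  have nin p : p \in [:: a; b] -> p \notin take (k - 2) rest.
    by move=> hp; apply/negP => /mem_take; rewrite mem_filter hp.
  by rewrite !nin // !inE eqxx ?orbT.
have hK p : p \in K -> p < l.
  rewrite !inE => /or3P[/eqP->|/eqP->|/mem_take] //.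
  by rewrite mem_filter mem_iota => /andP[].
have := hedges_card (walk_hedge sK uK hK).
set e := [set x | _] => ce.
have : #|e| <= size (undup [seq u p %% n | p <- K]).
  rewrite cardE -(size_map val); apply: uniq_leq_size.
    by rewrite map_inj_uniq ?enum_uniq //; apply: val_inj.
  by move=> y /mapP[x]; rewrite mem_enum inE mem_undup => + ->.
rewrite ce /= hab inE eqxx /= => h.
have := leq_trans h (size_undup (u b %% n :: [seq u p %% n | p <- take (k - 2) rest])).
by rewrite /= size_map -ltnS -/(size K) -{1}sK /= ltnn.
Qed.

Lemma walk_hyperclique : exists c : seq 'I_n,
  [/\ uniq c, is_hyperclique l [set x in c]
    & [seq u j %% n | j <- iota 0 l] = map val c].
Proof.
have lt j : u j %% n < n by rewrite ltn_pmod // walk_n_gt0.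
pose v j : 'I_n := Ordinal (lt j).
have v_inj : {in iota 0 l &, injective v}.
  by move=> a b; rewrite !mem_iota => /andP[_ ha] /andP[_ hb] /(congr1 val); apply: walk_inj.
have uc : uniq [seq v j | j <- iota 0 l] by rewrite map_inj_in_uniq ?iota_uniq.
exists [seq v j | j <- iota 0 l]; split=> //; last by rewrite -map_comp.
split.
  by rewrite cardsE (card_uniqP uc) size_map size_iota.
move=> e /subsetP sub ce.
pose K := [seq p <- iota 0 l | v p \in e].
have uK : uniq K by rewrite filter_uniq // iota_uniq.
have hK p : p \in K -> p < l by rewrite mem_filter mem_iota => /and3P[].
have eK : e = [set x in map v K].
  apply/setP => x; rewrite inE; apply/idP/mapP => [xe|[p]].
    have := sub x xe; rewrite inE => /mapP[p hp hx]; exists p => //.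
    by rewrite mem_filter -hx xe.
  by rewrite mem_filter => /andP[pe _] ->.
have uvK : uniq (map v K).
  rewrite map_inj_in_uniq // => a b; rewrite !mem_filter => /andP[_ ha] /andP[_ hb].
  exact: v_inj.
have sK : size K = k by rewrite -ce eK cardsE (card_uniqP uvK) size_map.
have := walk_hedge sK uK hK.
suff -> : e = [set x : 'I_n | val x \in [seq u p %% n | p <- K]] by [].
rewrite eK; apply/setP => x; rewrite !inE -(mem_map val_inj) -map_comp.
by [].
Qed.

End Walk.

Lemma hyperclique_walk (S : {set 'I_n}) : is_hyperclique l S ->
  exists u : nat -> nat,
  [/\ forall j, garc (u j) (u j.+1), u l = u 0,
      forall j, u j < l * T & forall j, u j %/ T = j %% l].
Proof.
move=> [cS hS].
have [x0 x0S] : exists x, x \in S by apply/card_gt0P; rewrite cS.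
have n_gt0 : 0 < n by apply: leq_ltn_trans (ltn_ord x0).
have T_gt0 : 0 < T by rewrite expn_gt0 n_gt0.
pose v j := nth x0 (enum S) (j %% l); pose f j := val (v j).
have sE : size (enum S) = l by rewrite -cardE.
have vS j : v j \in S by rewrite -mem_enum mem_nth // sE ltn_pmod.
have v_inj a b : v a = v b -> a = b %[mod l].
  by move/eqP; rewrite nth_uniq ?enum_uniq ?sE ?ltn_pmod // => /eqP.
have hf j t : f (j + t) < n by apply: ltn_ord.
have lay_lt j : j %% l < l by rewrite ltn_pmod.
pose F j t := f (j + t).
have hF j : forall t, F j t < n by apply: hf.
have num_lt j L := number_lt L (hF j).
exists (fun j => number n (F j) gam + (j %% l) * T); split.
- move=> j; set e := number n (F j) gam.+1.
  have he : e < n ^ gam.+1 by apply: num_lt.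
  (* The arc number combines the layer with the window of [gam.+1] vertices of [S] starting at
     [j]. *)
  exists (j %% l * n ^ gam.+1 + e).
    rewrite addnC /m; apply: (@leq_trans ((j %% l).+1 * n ^ gam.+1)).
      by rewrite mulSn ltn_add2r.
    by rewrite leq_mul2r lay_lt orbT.
  rewrite /src /arc_src /dst /arc_dst modnMDl (modn_small he).
  rewrite divnMDl ?expn_gt0 ?n_gt0 // (divn_small he) addn0.
  have we : is_window e.
    apply/is_windowP => // t st ut ht; apply: hS.
      apply/subsetP => x; rewrite inE => /mapP[p hp].
      rewrite (digit_number (hF j)) ?ht // => hx.
      by have -> : x = v (j + p) by apply/val_inj.
    transitivity #|[set x in [seq v (j + p) | p <- t]]|.
      apply: eq_card => x; rewrite !inE -(mem_map val_inj) -map_comp.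
      suff -> : [seq digit n e p | p <- t] = [seq (val \o (fun p => v (j + p))) p | p <- t] by [].
      by apply/eq_in_map => p hp /=; rewrite (digit_number (hF j)) ?ht.
    rewrite cardsE; have /card_uniqP-> : uniq [seq v (j + p) | p <- t].
      rewrite map_inj_in_uniq // => a b /ht ha /ht hb /v_inj /eqP.
      by rewrite eqn_modDl !modn_small ?(leq_trans ha) ?(leq_trans hb) // => /eqP.
    by rewrite size_map.
  rewrite we -/T (number_mod _ (hF j)) (number_div _ (hF j)).
  split=> //; congr (_ + _ * _); last by rewrite -(addn1 (j %% l)) modnDml addn1.
  by apply: eq_number => t; rewrite /F addSnnS.
- rewrite modnn mod0n; congr (_ + _); apply: eq_number => t.
  by rewrite /F /f /v modnDl.
- by move=> j; apply: node_lt.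
- by move=> j; rewrite addnC divnMDl // divn_small ?addn0.
Qed.

(** * The digraph and its shortest cycles *)

Section Digraph.

Variable N : nat.
Hypothesis N_ge : l * T + 1 + m <= N.

Lemma src_lt x : x < m -> src x < N.
Proof. by move/src_le => h; apply: leq_trans N_ge; rewrite addn1 ltn_addr. Qed.

Lemma dst_lt x : x < m -> dst x < N.
Proof.
move=> hx; apply: leq_trans N_ge; have n_gt0 := arcs_n_gt0 hx.
rewrite /dst /arc_dst -/T; case: ifP => _; last by rewrite ltn_add2l.
have he : x %% n ^ gam.+1 < n ^ gam.+1 by rewrite ltn_pmod // expn_gt0 n_gt0.
have [_ h] := arc_parts_lt n_gt0 he.
by rewrite -addnA ltn_addr //; apply: node_lt => //; rewrite ltn_pmod.
Qed.

Lemma src_neq_dst x : x < m -> src x != dst x.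
Proof.
move=> hx; have n_gt0 := arcs_n_gt0 hx.
have T_gt0 : 0 < T by rewrite expn_gt0 n_gt0.
have he : x %% n ^ gam.+1 < n ^ gam.+1 by rewrite ltn_pmod // expn_gt0 n_gt0.
have [h1 h2] := arc_parts_lt n_gt0 he; have hi := layer_lt hx.
rewrite /src /arc_src /dst /arc_dst -/T; case: ifP => _; last first.
  by rewrite -addnA -{1}[l * T]addn0 eqn_add2l.
apply/eqP => /(congr1 (fun z => z %/ T)).
rewrite ![_ + _ * T]addnC !divnMDl // (divn_small h1) (divn_small h2) !addn0.
(* An arc leads from layer [i] to layer [i.+1] modulo [l]; the wrap from [l - 1] to 0 is no loop
   because [l > 1]. *)
move: (x %/ _) hi => i hi; case: (leqP i.+2 l) => [h|h].
  by rewrite modn_small // => /eqP; rewrite ltn_eqF.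
have -> : i.+1 = l by apply/eqP; rewrite eqn_leq hi.
by rewrite modnn => i0; move: h; rewrite i0 ltnS leqNgt; case/negP; lia.
Qed.

Definition arc_list : seq ('I_N * 'I_N) :=
  [seq (Ordinal (src_lt (ltn_ord x)), Ordinal (dst_lt (ltn_ord x))) | x <- enum 'I_m].

Lemma arc_list_uniq : uniq arc_list.
Proof.
rewrite map_inj_uniq ?enum_uniq // => x y [hs hd]; apply/val_inj.
exact: arc_injective hs hd.
Qed.

Lemma arc_list_loopless u : (u, u) \notin [set a in arc_list].
Proof.
rewrite inE; apply/mapP => -[x _ [e1 e2]].
have := src_neq_dst (ltn_ord x); move/(congr1 val): e1; move/(congr1 val): e2 => /= <- <-.
by rewrite eqxx.
Qed.

Definition hyperclique_digraph : digraph := Digraph arc_list_loopless.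
Let G := hyperclique_digraph.

Lemma card_hyperclique_digraph : #|arcs G| = m.
Proof. by rewrite cardsE (card_uniqP arc_list_uniq) size_map size_enum_ord. Qed.

Lemma hyperclique_digraph_encoding :
  digraph_encodes G (N :: m :: flatten [seq [:: src j; dst j] | j <- iota 0 m]).
Proof.
exists arc_list.
  apply: uniq_perm; [exact: arc_list_uniq | exact: enum_uniq | move=> a].
  by rewrite mem_enum inE.
rewrite size_map size_enum_ord; congr [:: _, _ & flatten _].
by rewrite -map_comp -val_enum_ord -map_comp.
Qed.

Lemma arcs_garc (u v : 'I_N) : (u, v) \in arcs G <-> garc u v.
Proof.
rewrite inE; split=> [/mapP[x _ [-> ->]]|[x hx [hu hv]]].
  by exists (val x); first exact: ltn_ord.
apply/mapP; exists (Ordinal hx); first by rewrite mem_enum.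
by congr pair; apply/val_inj.
Qed.

Lemma hyperclique_dicycle (S : {set 'I_n}) : is_hyperclique l S ->
  exists2 c : seq 'I_(dnodes G), is_dicycle c & size c = l.
Proof.
move=> /hyperclique_walk[u [walk ul u_lt lay]].
have u_N j : u j < N.
  by apply: leq_trans (u_lt j) _; apply: leq_trans N_ge; rewrite -addnA leq_addr.
pose v j : 'I_(dnodes G) := Ordinal (u_N j).
exists [seq v j | j <- iota 0 l]; last by rewrite size_map size_iota.
split.
  by move/(congr1 size); rewrite size_map size_iota => l0; move: l_gt0; rewrite l0.
rewrite /ucycle; apply/andP; split; last first.
  (* The nodes are distinct because their layers are. *)
  rewrite map_inj_in_uniq ?iota_uniq // => a b; rewrite !mem_iota => /andP[_ ha] /andP[_ hb].
  by move/(congr1 (fun z => val z %/ T)); rewrite /= !lay !modn_small.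
have hpath a s : path (fun u v => (u, v) \in arcs G) (v a) [seq v j | j <- iota a.+1 s].
  by elim: s a => //= s IH a; rewrite IH andbT; apply/arcs_garc/walk.
have -> : iota 0 l = 0 :: iota 1 l.-1 by case: (l) l_gt0.
rewrite /=; have -> : v 0 = v l by apply/val_inj; rewrite /= ul.
rewrite -map_rcons; have -> : rcons (iota 1 l.-1) l = iota 1 l.
  by rewrite -[in RHS](prednK l_gt0) -(addn1 l.-1) iotaD cats1 add1n prednK.
have -> : v l = v 0 by apply/val_inj; rewrite /= ul.
exact: hpath.
Qed.

Lemma dicycle_walk (c : seq 'I_(dnodes G)) x0 : is_dicycle c ->
  forall j, garc (nth x0 c (j %% size c)) (nth x0 c (j.+1 %% size c)).
Proof.
move=> [c0 /andP[hc _]] j; apply/arcs_garc.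
exact: (@cycle_nth _ _ x0 c j hc c0).
Qed.

(** Cycles have length at least [l], and length [l] occurs exactly when there is a hyperclique, so
    one shortest cycle settles the question. Positivity of [n] serves the decoding modulo [n]. *)
Lemma digraph_solution_hyperclique out : shortest_cycle_solution G out ->
  (size out = l -> 0 < n) /\
  hyperclique_solution l H (if size out == l then [seq x %% n | x <- out] else [::]).
Proof.
case=> [[c [dc cmin] ->]|[noc ->]]; last first.
  rewrite ltn_eqF //=; split; first by move=> l0; move: l_gt0; rewrite -l0.
  by right; split=> // S /hyperclique_dicycle[c /noc].
have [x0 _] : exists x0, x0 \in c.
  by case: (c) dc => [[]//|x c' _]; exists x; rewrite inE eqxx.
pose u j := val (nth x0 c (j %% size c)).
have walk j : garc (u j) (u j.+1) by apply: dicycle_walk.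
rewrite size_map; split; first by move=> _; apply: walk_n_gt0 walk.
have c_gt0 : 0 < size c by case: (c) dc => [[]|].
have l_le : l <= size c.
  by apply: (closed_walk_length walk) => //; rewrite /u modnn mod0n.
case: eqP => sc; last first.
  right; split=> // S /hyperclique_dicycle[c' /cmin h sc'].
  by apply: sc; apply/eqP; rewrite eqn_leq l_le -sc' h.
left; have per j : u (j %% l) = u j by rewrite /u sc modn_mod.
have [d [ud hd vd]] := walk_hyperclique walk per.
exists d; split=> //; rewrite -vd -map_comp -sc.
apply: (@eq_from_nth _ 0); first by rewrite !size_map size_iota.
move=> i; rewrite size_map => hi.
rewrite (nth_map x0) // (nth_map 0) ?size_iota // nth_iota // add0n /u.
by rewrite (modn_small hi).
Qed.

End Digraph.

End Walks.

(** * The reduction *)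

Definition reduction (tps : seq (seq nat)) (l gam g : nat) (p : program) : program :=
  then_code (prologue tps l gam g) (then_code (relocate p) (epilogue l)) 0.

(** * Choice of the number of nodes and correctness of the reduction *)

Section Instance.

Variables (k q : nat) (H : hypergraph k).
Hypothesis k_gt2 : 2 < k.
Hypothesis q_gt1 : 1 < q.

Let n := hnodes H.
Let l := k * q.
Let gam := q * k.-1.
Let g := l + gam.+1 + 3.
Let m := l * n ^ gam.+1.
Let tps := pos_tuples gam.+1 k.
Let bit i := digit_set n k i \in hedges H.

(** With [b = 2 ^ (trunc_log 2 n).+1 > n], the part [l + gam.+1] of the exponent [g] makes room for
    [l * n ^ gam.+1], and the remaining 3 gives a factor 8 to spare. *)
Definition node_count : nat := 2 ^ trunc_log 2 n * (2 ^ (trunc_log 2 n).+1) ^ g.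
Let N := node_count.

Lemma node_countE : N = 2 ^ (trunc_log 2 n + (trunc_log 2 n).+1 * g).
Proof. by rewrite /N /node_count -expnM -expnD. Qed.

(** With [L = trunc_log 2 n], the bit length of [N] is [L + L.+1 * g + 1 = L.+1 * g.+1], an exact
    multiple of the bit length [L.+1]. *)
Lemma word_size_node_count c : word_size c N = word_size (c * g.+1) n.
Proof.
rewrite /word_size node_countE trunc_expnK // -addSn -mulnS.
by rewrite [X in c * X]mulnC mulnA.
Qed.

Let gam_gt0 : 0 < gam. Proof. rewrite /gam; nia. Qed.
Let l_gt0 : 0 < l. Proof. rewrite /l; nia. Qed.
Let k_le : k <= gam.+1. Proof. rewrite /gam; nia. Qed.

Let b := 2 ^ (trunc_log 2 n).+1.
Let B := b ^ (l + gam.+1).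

Let b_gt1 : 1 < b. Proof. by rewrite -{1}(expn0 2) ltn_exp2l. Qed.
Let n_lt_b : n < b. Proof. exact: trunc_log_ltn. Qed.

Lemma pow_le_B j : j <= gam.+1 -> n ^ j <= B.
Proof.
move=> hj; apply: (@leq_trans (b ^ j)); first by case: j hj => // j _; rewrite leq_exp2r // ltnW.
by rewrite leq_pexp2l ?(ltnW b_gt1) // (leq_trans hj) // leq_addl.
Qed.

Lemma l_pow_le_B j : j <= gam.+1 -> l * n ^ j <= B.
Proof.
move=> hj; rewrite /B expnD; apply: leq_mul.
  by apply: ltnW; apply: ltn_expl.
apply: (@leq_trans (b ^ j)); first by case: j hj => // j _; rewrite leq_exp2r // ltnW.
by rewrite leq_pexp2l ?(ltnW b_gt1).
Qed.

Lemma B_gt0 : 0 < B. Proof. by rewrite expn_gt0 ltnW. Qed.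

Lemma B8_le_N : 8 * B <= N.
Proof.
apply: (@leq_trans (b ^ g)); last by rewrite leq_pmull // expn_gt0.
rewrite /g expnD mulnC leq_mul2l; apply/orP; right.
by apply: (@leq_trans (2 ^ 3)) => //; rewrite leq_exp2r.
Qed.

Lemma node_count_ge : l * n ^ gam + 1 + m <= N.
Proof.
have h1 := l_pow_le_B (leqnn gam.+1); have h2 := l_pow_le_B (leqnSn gam).
have := B8_le_N; have := B_gt0; rewrite -/m in h1 *; lia.
Qed.

Definition gadget : digraph := hyperclique_digraph k_gt2 q_gt1 node_count_ge.

Definition gadget_code : seq nat := graph_code n gam l N bit tps m.

Lemma gadget_encodes : digraph_encodes gadget gadget_code.
Proof. exact: hyperclique_digraph_encoding. Qed.

Lemma card_gadget : #|arcs gadget| = m.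
Proof. exact: card_hyperclique_digraph. Qed.

(** Since [N] is a power of two, fitting in a word leaves room for its double. *)
Lemma double_node_count_le w : N < 2 ^ w -> 2 * N <= 2 ^ w.
Proof. by rewrite node_countE -expnS ltn_exp2l // leq_exp2l. Qed.

Lemma hypergraph_code_fits w : N < 2 ^ w ->
  size (hypergraph_code H) <= 2 ^ w /\ all (fun v => v < 2 ^ w) (hypergraph_code H).
Proof.
move=> hw; have h1 := B8_le_N; have h2 := B_gt0.
have h3 : n ^ k <= B by apply: pow_le_B.
have h4 : n <= B by rewrite -[n]expn1; apply: pow_le_B.
split; first by rewrite /= size_mkseq -/n; lia.
rewrite /= -/n; apply/andP; split; first by lia.
by apply/allP => v /mapP[i _ ->]; apply: (@leq_ltn_trans 1); [apply: leq_b1 | lia].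
Qed.

Lemma reduction_correct w (p : program) t :
  N < 2 ^ w ->
  halted p (run w p t (init_state gadget_code)) ->
  shortest_cycle_solution gadget (output (run w p t (init_state gadget_code))) ->
  exists t', [/\ t' <= prologue_time n gam l g tps + t + (size (reduce_code l) + 7),
    halted (reduction tps l gam g p)
      (run w (reduction tps l gam g p) t' (init_state (hypergraph_code H)))
    & hyperclique_solution l H
        (output (run w (reduction tps l gam g p) t' (init_state (hypergraph_code H))))].
Proof.
move=> hw; set fin := run w p t _; move=> halt_p sol.
have N_w := double_node_count_le hw.
have h8 := B8_le_N; have hB := B_gt0.
have m_N : m * 2 + 3 <= N by have := l_pow_le_B (leqnn gam.+1); rewrite -/m; lia.
have hc_N : n ^ k < N by have := pow_le_B k_le; lia.
have n_B : n <= B by rewrite -[n]expn1; apply: pow_le_B.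
have l_B : l <= B by rewrite -[l]muln1 -(expn0 n); apply: l_pow_le_B.
have l_N : l <= N by lia.
have pow_N j : j <= gam.+1 -> n ^ j <= N by move/pow_le_B; lia.
have log_N : b <= N.
  apply: leq_trans h8; apply: (@leq_trans B); last by rewrite leq_pmull.
  by rewrite -{1}[b]expn1 leq_pexp2l ?(ltnW b_gt1) // addnS.
have tps_size : all (fun t => size t == k) tps.
  by apply/allP => u; rewrite mem_pos_tuples => /and3P[].
set P := reduction tps l gam g p.
set c1 := prologue tps l gam g 0; set o := size c1.
set c3 := epilogue l (o + size p).
have srel : size (relocate p o) = size p by rewrite size_map.
have hP : P = [::] ++ c1 ++ (relocate p o ++ c3).
  by rewrite /P /reduction /then_code /= !add0n srel.
have [t1 [r1 [m1 [le1 run1 [r1n hm1] fr1]]]] :=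
  prologue_triple l_gt0 gam_gt0 k_le tps_size (erefl N) N_w m_N node_count_ge
    hc_N l_N pow_N log_N [::] (relocate p o ++ c3)
    (conj (fun=> erefl) (fun=> erefl) :
      (forall i, (fun=> 0) i = 0) /\ (forall a, nth 0 (hypergraph_code H) a = _)).
rewrite -hP /= add0n -/c1 -/o in run1.
(* The prologue leaves the registers from [scratch] on untouched, hence zero, as an initial state
   requires. *)
have mir0 : mirrors p c1 r1 (init_state gadget_code) (State o r1 m1).
  split=> //= [|i]; first by rewrite min0n addn0.
  by rewrite fr1 // leq_addr.
have [t2 le2] := mirrors_run w c3 t mir0; rewrite -/o -[c1 ++ _ ++ _]/([::] ++ _) -hP -/fin.
case e2 : (run w P t2 _) => [a2 r2 m2] [/= pc2 _ low2 mem2].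
rewrite (minn_idPr halt_p) -/o in pc2.
pose out := output fin.
have [n_gt0 hsol] := digraph_solution_hyperclique sol.
have szout : size out = memory fin 0 by rewrite size_mkseq.
have epi := @epilogue_triple w n l (size out) out l_gt0 _ n_gt0 _ id.
have [|||t3 [r3 [m3 [le3 run3 out3 _]]]] := epi _ _ (c1 ++ relocate p o) [::] r2 m2.
- by lia.
- by lia.
- split; first by rewrite low2.
    by rewrite mem2 szout.
  by move=> szl i hi; rewrite mem2 nth_mkseq // -szout szl.
rewrite cats0 size_cat srel -/o -catA -/c3 -[c1 ++ _ ++ _]/([::] ++ _) -hP in run3.
have runP : run w P (t1 + t2 + t3) (init_state (hypergraph_code H)) =
    State (o + size p + size c3) r3 m3.
  by rewrite !run_add run1 e2 pc2 run3.
exists (t1 + t2 + t3); split.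
- by rewrite !leq_add.
- rewrite runP /halted -[pc _]/(o + size p + size c3).
  by rewrite [size P](congr1 size hP) cat0s (size_cat c1) (size_cat (relocate p o)) srel addnA.
- by rewrite runP /output /= out3.
Qed.

Lemma prologue_time_le : 0 < n ->
  prologue_time n gam l g tps <=
  (size (setup_code l gam) + size (header_code g) + l * (emit_time tps).+2 + 14 * l + 25)
    * n ^ l.-1.
Proof.
move=> n_gt0.
(* [gam.+1 = l - q + 1] is at most [l - 1] because [q >= 2]. *)
have h1 : n ^ gam.+1 <= n ^ l.-1 by rewrite leq_pexp2l // /gam /l; case: (k) k_gt2 => // k' _; nia.
have h2 : trunc_log 2 n <= n ^ l.-1.
  apply: (@leq_trans n).
    exact: leq_trans (ltnW (ltn_expl _ (ltnSn 1))) (trunc_logP (ltnSn 1) n_gt0).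
  by rewrite -{1}[n]expn1 leq_pexp2l // /l; case: (k) k_gt2 => // k' _; nia.
have h3 : 0 < n ^ l.-1 by rewrite expn_gt0 n_gt0.
rewrite /prologue_time; move: (size _) (size _) (emit_time _) (trunc_log _ _) h2 => s1 s2 e L h2.
move: (n ^ l.-1) (n ^ gam.+1) h1 h2 h3 => X Y h1 h2 h3.
have h4 : l * Y <= l * X by rewrite leq_mul2l h1 orbT.
have h5 : l * Y * e.+2 <= l * X * e.+2 by rewrite leq_mul2r h4 orbT.
have h6 : s1 <= s1 * X by rewrite leq_pmulr.
have h7 : s2 <= s2 * X by rewrite leq_pmulr.
rewrite [leqRHS](_ : _ = s2 * X + s1 * X + l * X * e.+2 + 14 * (l * X) + 25 * X); last by ring.
move: (l * Y * e.+2) (l * X * e.+2) (l * X) (l * Y) (s1 * X) (s2 * X) h4 h5 h6 h7.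
by move=> *; lia.
Qed.

End Instance.

(** * Exponents and conclusion *)

Import Order.TTheory GRing.Theory Num.Theory.

Local Open Scope ring_scope.

(** With [a = k / (k - 1)], the exponent of [n] on the left is [(q (k - 1) + 1) (a - eps) = k q + a
    - eps q (k - 1) - eps]. It is at most [k q - 1] because [eps q (k - 1) >= eps q >= a + 1]. *)
Lemma window_powR_le (R : realType) (k q n : nat) (eps : R) : (2 < k)%N -> (1 < q)%N ->
  (0 < n)%N -> k%:R / (k%:R - 1) + 1 <= eps * q%:R -> 0 < eps ->
  (k * q * n ^ (q * k.-1).+1)%N%:R `^ (k%:R / (k%:R - 1) - eps) <=
  (k * q)%N%:R `^ (k%:R / (k%:R - 1) - eps) * n%:R ^+ (k * q).-1 :> R.
Proof.
move=> k_gt2 q_gt1 n_gt0; set a := k%:R / (k%:R - 1) => hq eps_gt0.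
have kq_gt0 : (0 < k * q)%N by rewrite muln_gt0 (ltn_trans _ k_gt2) // ltnW.
have n_ge1 : 1 <= n%:R :> R by rewrite ler1n.
rewrite natrM powRM // natrX -powR_mulrn // -powRrM ler_wpM2l ?powR_ge0 //.
rewrite -powR_mulrn //; apply: ler_powR => //.
have ek : (k.-1)%:R = k%:R - 1 :> R.
  by rewrite -{2}(prednK (ltn_trans (ltnSn 0) (ltnW k_gt2))) -natr1 addrK.
have k1_gt0 : 0 < k%:R - 1 :> R by rewrite -ek ltr0n; case: (k) k_gt2 => [|[]].
have ekq : (k * q).-1%:R = k%:R * q%:R - 1 :> R.
  by rewrite -natrM -{2}(prednK kq_gt0) -natr1 addrK.
have ha : a * (k%:R - 1) = k%:R by rewrite /a divfK // gt_eqF.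
rewrite ekq -natr1 natrM ek.
have -> : (q%:R * (k%:R - 1) + 1) * (a - eps) =
  q%:R * (a * (k%:R - 1)) + a - eps * q%:R * (k%:R - 1) - eps by ring.
rewrite ha.
have h2 : eps * q%:R <= eps * q%:R * (k%:R - 1).
  rewrite ler_peMr ?mulr_ge0 ?(ltW eps_gt0) // -ek ler1n.
  by case: (k) k_gt2 => [|[]].
by rewrite mulrC; lra.
Qed.

Theorem theorem1p8 (R : realType) (k : nat) (hk : (2 < k)%N)
    (hyp : forall l : nat, (k < l)%N -> hyperclique_hypothesis R l k) :
  requires_time shortest_cycle_problem (k%:R / (k%:R - 1) : R).
Proof.
move=> eps eps_gt0 [p [c [C [N0 solver]]]].
set a := k%:R / (k%:R - 1) in solver.
(* Large enough that [a + 1 <= eps * q], and at least 2 so that [l > k]. *)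
pose q := maxn 2 (Num.bound ((a + 1) / eps)).
have q_gt1 : (1 < q)%N by rewrite leq_max.
have a_ge0 : 0 <= a.
  by rewrite divr_ge0 // subr_ge0 ler1n; apply: leq_trans hk.
have hq : a + 1 <= eps * q%:R.
  rewrite mulrC -ler_pdivrMr //; apply: ltW.
  apply: lt_le_trans (archi_boundP _) _; first by rewrite divr_ge0 ?addr_ge0 // ltW.
  by rewrite ler_nat leq_maxr.
pose l := (k * q)%N; pose gam := (q * k.-1)%N; pose g := (l + gam.+1 + 3)%N.
pose tps := pos_tuples gam.+1 k.
have k_lt_l : (k < l)%N by rewrite /l -{1}[k]muln1 ltn_mul2l q_gt1 (ltn_trans _ hk).
(* Time [O(n ^ (l - 1))] contradicts the hypothesis with its own [eps] equal to 1. *)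
apply: (hyp l k_lt_l 1 ltr01).
pose A := (size (setup_code l gam) + size (header_code g) + l * (emit_time tps).+2 +
           14 * l + 25 + (size (reduce_code l) + 7))%N.
(* [C] may be negative, hence its absolute value. The threshold gives [n > 0] and also [N0 <= m],
   because [m = l * n ^ gam.+1 >= n]. *)
exists (reduction tps l gam g p), (c * g.+1)%N,
  (A%:R + `|C| * l%:R `^ (a - eps)), (maxn 1 N0).
move=> H s ->.
have [] := solver (gadget H hk q_gt1) _ (gadget_encodes H hk q_gt1).
rewrite /nodes /= word_size_node_count -/l -/gam -/g.
set w := word_size _ _.
(* The first word of the digraph code is [N], so the solver's guarantee on its input gives
   [N < 2 ^ w]. *)
move=> _ /andP[N_lt _] [t [halt_p sol time_p]].
have [fit1 fit2] := hypergraph_code_fits hk q_gt1 N_lt.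
have [t' [le_t' halt_P sol_P]] := reduction_correct N_lt halt_p sol.
split=> //; exists t'; split=> //.
rewrite /time_param /= geq_max => /andP[n_gt0 n_N0].
have l_gt0 : (0 < l)%N by apply: leq_ltn_trans k_lt_l.
have n_ge1 : 1 <= (hnodes H)%:R :> R by rewrite ler1n.
have -> : l%:R - 1 = l.-1%:R :> R by rewrite -{1}(prednK l_gt0) -natr1 addrK.
rewrite powR_mulrn // mulrDl.
move: time_p; rewrite /time_param /= card_gadget => time_p.
have {}time_p : t%:R <= `|C| * l%:R `^ (a - eps) * (hnodes H)%:R ^+ l.-1.
  apply: le_trans (time_p _) _.
    apply: leq_trans n_N0 _; apply: (@leq_trans (hnodes H ^ gam.+1)).
      by rewrite expnS leq_pmulr // expn_gt0 n_gt0.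
    by rewrite leq_pmull.
  apply: le_trans (ler_wpM2r (powR_ge0 _ _) (ler_norm C)) _.
  rewrite -mulrA ler_wpM2l //; exact: window_powR_le.
apply: le_trans (lerD (lexx _) time_p).
rewrite -natrX -natrM -natrD ler_nat; apply: leq_trans le_t' _.
rewrite addnAC leq_add2r mulnDl; apply: leq_add; first exact: prologue_time_le.
by rewrite leq_pmulr // expn_gt0 n_gt0.
Qed.
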